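(* Let $X$ and $Y$ be two geodesic semimetric spaces such that $X$ is hyperbolic and satisfies (B1) and (B2) (as defined in the context). If $X$ is quasi-isometric to $Y$, then $Y$ is hyperbolic.
   Context: A semimetric on a set $X$ is a map $d\colon X\times X\to[0,\infty]$ with $d(x,y)=0$ if and only if $x=y$, and $d(x,y)\le d(x,z)+d(z,y)$ for all $x,y,z\in X$ (no symmetry required); $(X,d)$ is then a semimetric space. For $r\ge 0$ put $\mathcal B^+_r(x)=\{y: d(x,y)\le r\}$ (out-ball), $\mathcal B^-_r(x)=\{y: d(y,x)\le r\}$ (in-ball); for $A\subseteq X$, $\mathcal B^{\pm}_r(A)=\bigcup_{a\in A}\mathcal B^{\pm}_r(a)$. The sets $\{y: d(x,y)<r\}$ generate the forward topology of $X$, and the sets $\{y:d(y,x)<r\}$ generate the backward topology. Paths. Equip a real interval $[a,b]$ with the semimetric $d(s,t)=t-s$ if $s\le t$ and $d(s,t)=\infty$ if $s>t$. A directed path in $X$ is a map $P\colon[a,b]\to X$ that is continuous for the forward topologies and also continuous for the backward topologies; $P(a)$ is its starting point, $P(b)$ its end point. Constant (trivial) paths are allowed. Its length is $\ell(P)=\lim_{N\to\infty}\sum_{i=1}^N d(P(t_{i-1}),P(t_i))$ with $t_i=a+i(b-a)/N$. A path is identified with its image when one speaks of points on $P$ or balls around $P$. An $x$-$y$ geodesic is a directed path $P$ from $x$ to $y$ with $d(P(s),P(t))=\ell(P|_{[s,t]})$ for all $s\le t$. $X$ is geodesic if there is an $x$-$y$ geodesic for all $x,y\in X$ with $d(x,y)<\infty$.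 Hyperbolicity. A geodesic triangle consists of three (not necessarily distinct) points and three geodesics (the sides), one between every two of those points (in either direction). It is $\delta$-thin if, whenever $P,Q,R$ are its sides labelled so that the starting point of $P$ is the starting or end point of $Q$ and the end point of $P$ is the starting or end point of $R$, then $P\subseteq\mathcal B^+_\delta(Q)\cup\mathcal B^-_\delta(R)$. A geodesic semimetric space is $\delta$-hyperbolic if all its geodesic triangles are $\delta$-thin, and hyperbolic if it is $\delta$-hyperbolic for some $\delta\ge0$. (B1): there is a function $f\colon\mathbb R\to\mathbb R$ such that for every $x\in X$, every $r\ge0$ and all $y,z\in\mathcal B^+_r(x)$, either $d(y,z)=\infty$ or $d(y,z)\le f(r)$. (B2): the same with $\mathcal B^-_r(x)$ in place of $\mathcal B^+_r(x)$. Quasi-isometry. A map $f\colon X\to Y$ between semimetric spaces is a quasi-isometry if there are $\gamma\ge1$, $c\ge0$ with $\gamma^{-1}d_X(x,x')-c\le d_Y(f(x),f(x'))\le\gamma d_X(x,x')+c$ for all $x,x'\in X$ (with the usual conventions for $\infty$), and for every $y\in Y$ there is $x\in X$ with $d_Y(f(x),y)\le c$ and $d_Y(y,f(x))\le c$. Then $X$ is called quasi-isometric to $Y$ (this is an equivalence relation). *)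

(* Defs.v *)
From HB Require Import structures.
From mathcomp Require Import all_boot all_order all_algebra.
From mathcomp Require Import all_classical all_reals all_analysis.

Set Implicit Arguments.
Unset Strict Implicit.
Unset Printing Implicit Defensive.

Import Order.TTheory GRing.Theory Num.Theory.
Import numFieldNormedType.Exports.

Local Open Scope classical_set_scope.
Local Open Scope ring_scope.
Local Open Scope ereal_scope.

HB.mixin Record isSemimetric (R : realType) X := {
  sdist : X -> X -> \bar R;
  sdist_ge0 : forall x y, 0 <= sdist x y;
  sdist_eq0 : forall x y, sdist x y = 0 <-> x = y;
  sdist_triangle : forall x y z, sdist x y <= sdist x z + sdist z y
}.

#[short(type="semimetricType")]
HB.structure Definition Semimetric (R : realType) :=
  { X of Choice X & isSemimetric R X }.

(* The two topologies live on two aliases of the carrier. The library factory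
   takes the family of open balls as a subbase. *)
Section Topologies.
Context {R : realType} (X : semimetricType R).

Definition open_out_balls : set (set X) :=
  [set B | exists (x : X) (r : R), B = [set y | sdist x y < r%:E]].

Definition open_in_balls : set (set X) :=
  [set B | exists (x : X) (r : R), B = [set y | sdist y x < r%:E]].

Definition forward : Type := X.
HB.instance Definition _ := Choice.on forward.
HB.instance Definition _ :=
  isSubBaseTopological.Build forward open_out_balls id.

Definition backward : Type := X.
HB.instance Definition _ := Choice.on backward.
HB.instance Definition _ :=
  isSubBaseTopological.Build backward open_in_balls id.

End Topologies.

Definition dicontinuous (R : realType) (X Y : semimetricType R) (A : set X)
    (f : X -> Y) : Prop :=
  {within (A : set (forward X)), continuous (f : forward X -> forward Y)} /\
  {within (A : set (backward X)), continuous (f : backward X -> backward Y)}.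

(* Real intervals are treated as subspaces of the directed line. *)
Definition dline (R : realType) : Type := R.

Section DirectedLine.
Context {R : realType}.

HB.instance Definition _ := Choice.on (dline R).

Definition dline_dist (s t : dline R) : \bar R :=
  if ((s : R) <= t)%R then ((t : R) - s)%:E else +oo.

Let dline_dist_ge0 s t : 0 <= dline_dist s t.
Proof. by rewrite /dline_dist; case: ifPn => // st; rewrite lee_fin subr_ge0. Qed.

Let dline_dist_eq0 s t : dline_dist s t = 0 <-> s = t.
Proof.
rewrite /dline_dist; split => [|->]; last by rewrite lexx subrr.
by case: ifPn => // _ [] /eqP; rewrite subr_eq0 => /eqP.
Qed.

Let dline_dist_triangle s t u :
  dline_dist s t <= dline_dist s u + dline_dist u t.
Proof.
rewrite /dline_dist; case: (leP (s : R) u) => su; last first.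
  by rewrite addye ?leey//; case: ifP.
case: (leP (u : R) t) => ut; last by rewrite addey ?leey.
by rewrite (le_trans su ut) -EFinD lee_fin [leRHS]addrC addrA subrK.
Qed.

HB.instance Definition _ := isSemimetric.Build R (dline R)
  dline_dist_ge0 dline_dist_eq0 dline_dist_triangle.

End DirectedLine.

Section Geometry.
Context {R : realType} (X : semimetricType R).
Implicit Types (x y z : X) (A B : set X).

Definition out_ball (r : R) x : set X := [set y | sdist x y <= r%:E].
Definition in_ball (r : R) x : set X := [set y | sdist y x <= r%:E].
Definition out_nbhd (r : R) A : set X := \bigcup_(a in A) out_ball r a.
Definition in_nbhd (r : R) A : set X := \bigcup_(a in A) in_ball r a.

(* Only the values of [dpath_map] on [dpath_lo, dpath_hi] are meaningful. *)
Record dpath := DPath {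
  dpath_lo : R;
  dpath_hi : R;
  dpath_map :> R -> X;
  dpath_le : (dpath_lo <= dpath_hi)%R;
  dpath_cont :
    @dicontinuous R (dline R) X [set` `[dpath_lo, dpath_hi]] dpath_map
}.

Definition dpath_start (P : dpath) : X := P (dpath_lo P).
Definition dpath_end (P : dpath) : X := P (dpath_hi P).
Definition dpath_points (P : dpath) : set X :=
  [set P t | t in `[dpath_lo P, dpath_hi P]].

(* Length of the restriction of P to [s, t]; the term N = 0 is an empty sum. *)
Definition dlength (P : R -> X) (s t : R) : \bar R :=
  let node (N i : nat) : R := (s + i%:R * (t - s) / N%:R)%R in
  limn (fun N : nat =>
    \sum_(i < N) sdist (P (node N i)) (P (node N i.+1))).

Definition geodesic (P : dpath) : Prop :=
  forall s t : R, (dpath_lo P <= s)%R -> (s <= t)%R -> (t <= dpath_hi P)%R ->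
    sdist (P s) (P t) = dlength P s t.

Definition geodesic_space : Prop :=
  forall x y, sdist x y < +oo ->
    exists P : dpath, [/\ geodesic P, dpath_start P = x & dpath_end P = y].

Definition joins (P : dpath) x y : Prop :=
  (dpath_start P = x /\ dpath_end P = y) \/
  (dpath_start P = y /\ dpath_end P = x).

(* [S i] is the side opposite to the corner [p i]; corners may coincide. *)
Definition geodesic_triangle (p : 'I_3 -> X) (S : 'I_3 -> dpath) : Prop :=
  forall i j k : 'I_3, uniq [:: i; j; k] ->
    geodesic (S i) /\ joins (S i) (p j) (p k).

Definition is_endpoint x (P : dpath) : Prop :=
  x = dpath_start P \/ x = dpath_end P.

Definition thin (delta : R) (S : 'I_3 -> dpath) : Prop :=
  forall i j k : 'I_3, uniq [:: i; j; k] ->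
    is_endpoint (dpath_start (S i)) (S j) ->
    is_endpoint (dpath_end (S i)) (S k) ->
    dpath_points (S i) `<=`
      out_nbhd delta (dpath_points (S j)) `|` in_nbhd delta (dpath_points (S k)).

Definition delta_hyperbolic (delta : R) : Prop :=
  forall (p : 'I_3 -> X) (S : 'I_3 -> dpath),
    geodesic_triangle p S -> thin delta S.

Definition hyperbolic : Prop :=
  exists delta : R, (0 <= delta)%R /\ delta_hyperbolic delta.

Definition B1 : Prop :=
  exists f : R -> R, forall x (r : R), (0 <= r)%R ->
    forall y z, out_ball r x y -> out_ball r x z ->
      sdist y z = +oo \/ sdist y z <= (f r)%:E.

Definition B2 : Prop :=
  exists f : R -> R, forall x (r : R), (0 <= r)%R ->
    forall y z, in_ball r x y -> in_ball r x z ->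
      sdist y z = +oo \/ sdist y z <= (f r)%:E.

End Geometry.

Definition quasi_isometry (R : realType) (X Y : semimetricType R)
    (f : X -> Y) : Prop :=
  exists gamma c : R, [/\ (1 <= gamma)%R, (0 <= c)%R,
    (forall x x' : X,
      (gamma^-1)%:E * sdist x x' - c%:E <= sdist (f x) (f x') /\
      sdist (f x) (f x') <= gamma%:E * sdist x x' + c%:E) &
    (forall y : Y, exists x : X,
      sdist (f x) y <= c%:E /\ sdist y (f x) <= c%:E)].

Definition quasi_isometric (R : realType) (X Y : semimetricType R) : Prop :=
  exists f : X -> Y, quasi_isometry f.

(* Main.v *)
Require Import Defs.
From mathcomp Require Import all_boot all_order all_algebra.
From mathcomp Require Import all_classical all_reals all_analysis.
From mathcomp Require Import finmap zify ring lra.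

(** Reversing all distances and paths preserves the hypotheses, so every
    one-sided estimate has a dual. In a hyperbolic space with (B1) and (B2) the
    contraction bounds may be taken linear: points sampled at constant steps on
    one side of a triangle cannot crowd near the other two sides. Contraction
    also upgrades thinness of a triangle x -> y, x -> z to an estimate in which
    the points of the first side reach one of the other sides with the
    direction of travel fixed. Such estimates can be iterated along bisections
    of a quasi-geodesic, so a geodesic is within logarithmic distance of a
    quasi-geodesic with the same ends, in both directions. If the two are
    mutually D-near, cutting out a piece of length O(D) around a point, whose
    ends are D-near the quasi-geodesic, bounds the distance of that point by
    O(log D); hence D improves down to a constant. Triangles in Y are then
    compared with the geodesic triangles of X spanned by the images of their
    corners under a quasi-inverse. *)

Set Implicit Arguments.
Unset Strict Implicit.
Unset Printing Implicit Defensive.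

Import Order.TTheory GRing.Theory Num.Theory.

Local Open Scope classical_set_scope.
Local Open Scope ring_scope.

(* [lra] preprocesses every hypothesis; discarding the irrelevant ones first
   makes it much faster in the long contexts below. *)
Ltac arith :=
  repeat match goal with
  | [ H : ?P |- _ ] =>
    lazymatch type of P with
    | Prop => lazymatch P with
              | is_true _ => fail
              | @eq _ _ _ => fail
              | _ => clear H
              end
    | _ => fail
    end
  end; lra.

Definition ends (R : realType) (T : Type) (p : R -> T) (a b : R) (x y : T) :=
  (p a = x /\ p b = y) \/ (p a = y /\ p b = x).

(* [near r x y] stands for d x y <= r, so infinite distances need no special
   treatment; [arc p a b] says that p restricts to an isometric geodesic on the
   directed interval [a, b]. *)
Record hypspace (R : realType) (T : Type) (near : R -> T -> T -> Prop)
    (arc : (R -> T) -> R -> R -> Prop) (delta : R) (f : R -> R) : Prop := {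
  near_ge0 : forall r x y, near r x y -> 0 <= r;
  near_refl : forall r x, 0 <= r -> near r x x;
  near_le : forall r s x y, near r x y -> r <= s -> near s x y;
  near_trans : forall r s x y z, near r x y -> near s y z -> near (r + s) x z;
  arc_le : forall p a b, arc p a b -> a <= b;
  arc_near : forall p a b r s t, arc p a b -> a <= s -> s <= t -> t <= b ->
    near r (p s) (p t) <-> t - s <= r;
  arc_sub : forall p a b s t, arc p a b -> a <= s -> s <= t -> t <= b ->
    arc p s t;
  arc_ex : forall r x y, near r x y ->
    exists p a b, [/\ arc p a b, p a = x & p b = y];
  delta_ge0 : 0 <= delta;
  arc_thin : forall p a b q c d r e g z t, arc p a b -> arc q c d ->
    arc r e g -> ends q c d (p a) z -> ends r e g z (p b) -> a <= t <= b ->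
    (exists2 s, c <= s <= d & near delta (q s) (p t)) \/
    (exists2 s, e <= s <= g & near delta (p t) (r s));
  out_contract : forall r s x y z, near r x y -> near r x z -> near s y z ->
    near (f r) y z;
  in_contract : forall r s x y z, near r y x -> near r z x -> near s y z ->
    near (f r) y z
}.

Section ArcDistance.
Context (R : realType) (T : Type) (near : R -> T -> T -> Prop)
  (arc : (R -> T) -> R -> R -> Prop) (delta : R) (f : R -> R).
Hypothesis H : hypspace near arc delta f.

Lemma near_on_arc p a b r s t : arc p a b -> a <= s <= t -> t <= b ->
  t - s <= r -> near r (p s) (p t).
Proof. by move=> pab /andP[as_ st] tb; apply: proj2 (arc_near H _ pab as_ st tb). Qed.

Lemma arc_dist_le p a b r s t : arc p a b -> a <= s <= t -> t <= b ->
  near r (p s) (p t) -> t - s <= r.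
Proof. by move=> pab /andP[as_ st] tb; apply: proj1 (arc_near H _ pab as_ st tb). Qed.

Lemma arc_length_le p a b r : arc p a b -> near r (p a) (p b) -> b - a <= r.
Proof.
by move=> pab; apply: (arc_dist_le pab); rewrite lexx /= ?(arc_le H pab).
Qed.

End ArcDistance.

Section Opposite.
Context (R : realType) (T : Type).

Definition opp_near (near : R -> T -> T -> Prop) r x y := near r y x.
Definition opp_arc (arc : (R -> T) -> R -> R -> Prop) p a b :=
  arc (p \o -%R) (- b) (- a).

Lemma endsN (p : R -> T) a b x y :
  ends p a b x y -> ends (p \o -%R) (- b) (- a) x y.
Proof. by rewrite /ends /= !opprK; tauto. Qed.

Lemma endsC (p : R -> T) a b x y : ends p a b x y -> ends p a b y x.
Proof. by rewrite /ends; tauto. Qed.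

Lemma hypspace_opp near arc delta f : @hypspace R T near arc delta f ->
  hypspace (opp_near near) (opp_arc arc) delta f.
Proof.
move=> H; split; rewrite /opp_near /opp_arc.
- by move=> r x y; exact: near_ge0 H _ _ _.
- by move=> r x; exact: near_refl H _ _.
- by move=> r s x y; exact: near_le H _ _ _ _.
- by move=> r s x y z xy yz; rewrite addrC; exact: near_trans H _ _ _ _ _ yz xy.
- by move=> p a b /(arc_le H); rewrite lerN2.
- move=> p a b r s t pab as_ st tb.
  have := @arc_near _ _ _ _ _ _ H _ _ _ r (- t) (- s) pab.
  by rewrite /= !opprK !lerN2 addrC; exact.
- by move=> p a b s t pab as_ st tb; apply: (arc_sub H) pab _ _ _; rewrite lerN2.
- move=> r x y /(arc_ex H)[p [a [b [pab pa pb]]]].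
  exists (p \o -%R), (- b), (- a); rewrite /= !opprK; split => //.
  by rewrite (_ : (p \o -%R) \o -%R = p)//; apply/funext => u /=; rewrite opprK.
- exact: delta_ge0 H.
- move=> p a b q c d r e g z t pab qcd reg q1 r1 tab.
  have e1 : ends (r \o -%R) (- g) (- e) ((p \o -%R) (- b)) z.
    by rewrite /= opprK; exact/endsN/endsC.
  have e2 : ends (q \o -%R) (- d) (- c) z ((p \o -%R) (- a)).
    by rewrite /= opprK; exact/endsN/endsC.
  have tI : - b <= - t <= - a by arith.
  have [[s sI hs]|[s sI hs]] := arc_thin H pab reg qcd e1 e2 tI.
  + by right; exists (- s); [arith|move: hs; rewrite /= opprK].
  + by left; exists (- s); [arith|move: hs; rewrite /= opprK].
- by move=> r s x y z xy xz yz; exact: (in_contract H xz xy yz).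
- by move=> r s x y z xy xz yz; exact: (out_contract H xz xy yz).
Qed.

End Opposite.

Lemma pigeonhole (R : realType) (m : nat)
    (L : 'I_(m + m).+1 -> bool -> 'I_m -> Prop) :
  (forall i, exists b k, L i b k) ->
  exists i j : 'I_(m + m).+1, exists b k, [/\ (i < j)%N, L i b k & L j b k].
Proof.
move=> H; have {}H i : exists bk : bool * 'I_m, L i bk.1 bk.2.
  by have [b [k hk]] := H i; exists (b, k).
have [g gL] := choice H.
have /injectivePn[i [j ij gij]] : ~~ injectiveb g.
  apply/negP => /injectiveP /leq_card.
  by rewrite card_prod card_bool !card_ord mul2n -addnn ltnn.
have [lt|lt|e] := ltngtP i j; last by move: ij; rewrite (ord_inj e) eqxx.
- by exists i, j, (g i).1, (g i).2; split => //; rewrite gij.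
- by exists j, i, (g i).1, (g i).2; split => //; rewrite gij.
Qed.

Section Contract.
Context (R : realType) (T : Type) (near : R -> T -> T -> Prop)
  (arc : (R -> T) -> R -> R -> Prop) (delta : R) (f : R -> R).
Hypothesis H : hypspace near arc delta f.

(* Sample the side [y, z] at steps longer than f (delta + 1): by thinness two
   samples close to the same unit piece of another side would be too close. *)
Lemma out_contract_linear : exists2 A : R, 1 <= A &
  forall r s x y z, near r x y -> near r x z -> near s y z ->
    near (A * (r + 1)) y z.
Proof.
set h := Num.max 0 (f (delta + 1)) + 1.
have h1 : 1 <= h by rewrite /h lerDr le_max lexx.
have fh : f (delta + 1) <= h - 1 by rewrite /h addrK le_max lexx orbT.
exists (2 * h); first arith.
move=> r s x y z xy xz yz.
have r0 := near_ge0 H xy.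
have [p [a [b [pab pa pb]]]] := arc_ex H yz.
have [q [c [d [qcd qc qd]]]] := arc_ex H xy.
have [w [e [g [weg we wg]]]] := arc_ex H xz.
have ab := arc_le H pab; have cd := arc_le H qcd; have eg := arc_le H weg.
suff ba : b - a <= 2 * h * (r + 1).
  by rewrite -pa -pb; apply: (near_on_arc H pab); rewrite ?lexx //=.
have dcr : d - c <= r by apply: (arc_length_le H qcd); rewrite qc qd.
have ger : g - e <= r by apply: (arc_length_le H weg); rewrite we wg.
rewrite leNgt; apply/negP => ltab.
set m := (Num.truncn r).+1.
have mr : m%:R <= r + 1 by rewrite /m -natr1 lerD2r truncn_le.
have label u v : u <= v <= u + r -> exists k : 'I_m, k%:R <= v - u < k%:R + 1.
  move=> uv; have vu : 0 <= v - u by arith.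
  have km : (Num.truncn (v - u) < m)%N by rewrite ltnS le_truncn//; arith.
  by exists (Ordinal km); rewrite /= natr1 truncn_itv.
pose t (i : nat) := a + i%:R * h.
have tI (i : 'I_(m + m).+1) : a <= t i <= b.
  have : i%:R <= (m + m)%:R :> R by rewrite ler_nat -ltnS.
  rewrite natrD => im; have := ler0n R i => i0.
  have : i%:R * h <= (m%:R + m%:R) * h by rewrite ler_wpM2r//; arith.
  have : m%:R * h <= (r + 1) * h by rewrite ler_wpM2r//; arith.
  have : 0 <= i%:R * h by rewrite mulr_ge0//; arith.
  by rewrite /t; arith.
have [i|i [j [bb [k [ij Li Lj]]]]] := @pigeonhole R m (fun i bb k => if bb then
    exists2 v, c <= v <= d & k%:R <= v - c < k%:R + 1 /\ near delta (q v) (p (t i))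
  else
    exists2 v, e <= v <= g & k%:R <= v - e < k%:R + 1 /\ near delta (p (t i)) (w v)).
  have e1 : ends q c d (p a) x by rewrite pa; right.
  have e2 : ends w e g x (p b) by rewrite pb; left.
  have [[v vI hv]|[v vI hv]] := arc_thin H pab qcd weg e1 e2 (tI i).
  - by have [|k hk] := label c v; [arith|exists true, k, v].
  - by have [|k hk] := label e v; [arith|exists false, k, v].
have tij : t j - t i >= h.
  have : (i%:R + 1 : R) <= j%:R by rewrite natr1 ler_nat.
  move=> {}ij; rewrite /t (_ : _ - _ = (j%:R - i%:R) * h); last by ring.
  by rewrite -[leLHS]mul1r ler_wpM2r//; arith.
have ti := tI i; have tj := tI j.
have pij : near (t j - t i) (p (t i)) (p (t j)).
  by apply: (near_on_arc H pab); arith.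
have d0 := delta_ge0 H.
suff : near (f (delta + 1)) (p (t i)) (p (t j)).
  move=> hij; have : t j - t i <= f (delta + 1).
    by apply: (arc_dist_le H pab) hij; arith.
  by arith.
case: bb Li Lj.
- move=> [v vI [vk hv]] [v' vI' [vk' hv']].
  have [vv|vv] := leP v v'.
  + apply: (out_contract H) pij; first by apply: (near_le H) hv _; arith.
    have : near 1 (q v) (q v') by apply: (near_on_arc H qcd); arith.
    by move/(near_trans H)/(_ hv'); rewrite addrC.
  + apply: (out_contract H) pij; last by apply: (near_le H) hv' _; arith.
    have : near 1 (q v') (q v) by apply: (near_on_arc H qcd); arith.
    by move/(near_trans H)/(_ hv); rewrite addrC.
- move=> [v vI [vk hv]] [v' vI' [vk' hv']].
  have [vv|vv] := leP v v'.
  + apply: (in_contract H) pij; last by apply: (near_le H) hv' _; arith.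
    have : near 1 (w v) (w v') by apply: (near_on_arc H weg); arith.
    by move/(near_trans H hv).
  + apply: (in_contract H) pij; first by apply: (near_le H) hv _; arith.
    have : near 1 (w v') (w v) by apply: (near_on_arc H weg); arith.
    by move/(near_trans H hv').
Qed.

End Contract.

Lemma hypspace_linear (R : realType) (T : Type) near arc delta f :
  @hypspace R T near arc delta f ->
  exists2 A : R, 1 <= A & hypspace near arc delta (fun r => A * (r + 1)).
Proof.
move=> H; have [A1 A1_1 h1] := out_contract_linear H.
have [A2 A2_1 h2] := out_contract_linear (hypspace_opp H).
exists (Num.max A1 A2); first by rewrite le_max A1_1.
case: H => n0 nr nl nt al an asub aex d0 thn _ _; split => //.
- move=> r s x y z xy xz yz; apply: nl (h1 _ _ _ _ _ xy xz yz) _.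
  by rewrite ler_wpM2r ?le_max ?lexx//; have := n0 _ _ _ xy; arith.
- move=> r s x y z xy xz yz; apply: nl (h2 _ _ _ _ _ xz xy yz) _.
  by rewrite ler_wpM2r ?le_max ?lexx ?orbT//; have := n0 _ _ _ xy; arith.
Qed.
(** * Stability of quasi-geodesics *)

Lemma exists_almost_last (R : realType) (S : set R) (a b : R) : S a ->
  (forall t, S t -> t <= b) ->
  exists2 t, S t & forall t', S t' -> t' < t + 1.
Proof.
move=> Sa Sb; have hs : has_sup S by split; [exists a|exists b].
have [t St lt] := sup_adherent (@ltr01 R) hs.
exists t => // t' St'; have : t' <= sup S by apply: ub_le_sup => //; case: hs.
by arith.
Qed.

Section Linear.
Context (R : realType) (T : Type) (near : R -> T -> T -> Prop)
  (arc : (R -> T) -> R -> R -> Prop) (delta A : R).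
Hypothesis A1 : 1 <= A.
Local Notation F r := (A * (r + 1)).
Hypothesis H : hypspace near arc delta (fun r => F r).

Lemma near_rev r s x y : near r x y -> near s y x -> near (F r) y x.
Proof.
move=> xy yx; apply: (out_contract H xy) yx.
by apply: (near_refl H); exact: (near_ge0 H xy).
Qed.

Definition thin_const := 3 * delta + F (2 * delta) + 2.

(* Unlike in thinness, the estimate starts at p t in both cases, so that it can
   be iterated without composing opposite directions. It fails in general when
   q runs from z to p a. *)
Lemma out_thin p a b q c d w e g z : arc p a b -> arc q c d -> arc w e g ->
  q c = p a -> q d = z -> ends w e g z (p b) -> forall t, a <= t <= b ->
  (exists2 s, c <= s <= d & near thin_const (p t) (q s)) \/
  (exists2 s, e <= s <= g & near thin_const (p t) (w s)).
Proof.
move=> pab qcd weg qc qd wzb t tab.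
have d0 := delta_ge0 H.
have A2d : 2 * delta + 1 <= F (2 * delta).
  by rewrite -[leLHS]mul1r ler_wpM2r//; arith.
have cd := arc_le H qcd; have eg := arc_le H weg; have ab := arc_le H pab.
have e1 : ends q c d (p a) z by left.
pose S := [set u | a <= u <= b /\ exists2 s, c <= s <= d & near delta (q s) (p u)].
have Sa : S a.
  split; first by rewrite lexx.
  by exists c; [rewrite lexx|rewrite qc; exact: near_refl H _ _ d0].
have [m [mab [s' s'I s'm]] mlast] := exists_almost_last Sa (b := b)
  (fun t St => (andP (proj1 St)).2).
have toR u : a <= u <= b -> u <= m + 1 ->
    exists2 s, e <= s <= g & near (delta + (m + 1 - u)) (p u) (w s).
  move=> uab um; have [mb|mb] := leP (m + 1) b.
    have mI : a <= m + 1 <= b by arith.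
    have [[s sI hs]|[s sI hs]] := arc_thin H pab qcd weg e1 wzb mI.
      have : S (m + 1) by split => //; exists s.
      by move/mlast; rewrite ltxx.
    exists s => //; rewrite addrC; apply: (near_trans H) hs.
    by apply: (near_on_arc H pab); arith.
  have pub : near (delta + (m + 1 - u)) (p u) (p b).
    by apply: (near_on_arc H pab); arith.
  case: wzb => -[we wg].
    by exists g; [rewrite lexx eg|rewrite wg].
  by exists e; [rewrite lexx eg|rewrite we].
have [[s sI hs]|[s sI hs]] := arc_thin H pab qcd weg e1 wzb tab; last first.
  by right; exists s => //; apply: (near_le H) hs _; rewrite /thin_const; arith.
have tm : t < m + 1 by apply: mlast; split => //; exists s.
have [mt|mt] := leP (m - (2 * delta + F (2 * delta) + 1)) t.
  have [|s2 s2I h2] := toR t tab; first arith.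
  by right; exists s2 => //; apply: (near_le H) h2 _; rewrite /thin_const; arith.
left; set t1 := t + 2 * delta.
have [x [k [l [xkl xk xl]]]] := arc_ex H s'm.
have kl := arc_le H xkl.
have lk : l - k <= delta by apply: (arc_length_le H xkl); rewrite xk xl.
have pam : arc p a m by apply: (arc_sub H pab); arith.
have qcs : arc q c s' by apply: (arc_sub H qcd); arith.
have e2 : ends q c s' (p a) (q s') by left.
have e3 : ends x k l (q s') (p m) by left.
have t1I : a <= t1 <= m by rewrite /t1; arith.
have t1m r : near r (p t1) (p m) -> m - t1 <= r.
  by apply: (arc_dist_le H pam); rewrite ?lexx.
have pt1m : near (m - t1) (p t1) (p m).
  by apply: (near_on_arc H pam); rewrite ?lexx.
have [[s1 s1I hs1]|[s1 s1I hs1]] := arc_thin H pam qcs xkl e2 e3 t1I; last first.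
  have : near (delta + delta) (p t1) (p m).
    apply: (near_trans H hs1); rewrite -xl; apply: (near_on_arc H xkl); arith.
  by move/t1m; rewrite /t1; arith.
exists s1; first arith.
have e4 : ends p a m (q c) (p m) by left.
have e5 : ends x k l (p m) (q s') by right.
have s1I' : c <= s1 <= s' by arith.
have [[t2 t2I ht2]|[u uI hu]] := arc_thin H qcs pam xkl e4 e5 s1I'; last first.
  have : near (delta + delta) (q s1) (p m).
    by apply: (near_trans H hu); rewrite -xl; apply: (near_on_arc H xkl); arith.
  have hs1' : near (delta + delta) (q s1) (p t1) by apply: (near_le H) hs1 _; arith.
  move/(out_contract H hs1')/(_ pt1m)/t1m.
  by rewrite -mulr2n -[delta *+ 2]mulr_natl /t1; arith.
have ht : near (2 * delta) (p t2) (p t1).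
  by rewrite mulr_natl mulr2n; exact: (near_trans H ht2 hs1).
have : t2 - t <= 2 * delta + F (2 * delta).
  have [t12|t21] := leP t1 t2; last by rewrite /t1 in t21 *; arith.
  have h12 : near (t2 - t1) (p t1) (p t2) by apply: (near_on_arc H pam); arith.
  have : t2 - t1 <= F (2 * delta).
    by apply: (arc_dist_le H pam); [arith|arith|exact: (near_rev ht h12)].
  by rewrite /t1; arith.
have [tt2 h|t2t _] := leP t t2.
  have : near (2 * delta + F (2 * delta)) (p t) (p t2).
    by apply: (near_on_arc H pam); arith.
  by move/(near_trans H)/(_ ht2)/(near_le H); apply; rewrite /thin_const; arith.
have : t1 - t2 <= 2 * delta by apply: (arc_dist_le H pam) ht; rewrite /t1; arith.
by rewrite /t1; arith.
Qed.

Local Notation K := thin_const.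

Lemma A_ge0 : 0 <= A.
Proof. exact: le_trans A1. Qed.

Lemma thin_const_ge : 2 + delta <= K.
Proof.
have := delta_ge0 H => d0; rewrite /thin_const.
have : 0 <= F (2 * delta) by apply: mulr_ge0; [exact: A_ge0|arith].
by arith.
Qed.

Lemma F_ge r : 0 <= r -> r + 1 <= F r.
Proof. by move=> r0; rewrite -[leLHS]mul1r ler_wpM2r//; arith. Qed.

Lemma F_mono r s : r <= s -> F r <= F s.
Proof. by move=> rs; apply: (ler_wpM2l A_ge0); arith. Qed.

(* The detour p a <- u -> v <- p b cannot help p t, because contraction forces
   t to be within F D of an endpoint that p t reaches through the detour. *)
Lemma quadrilateral_out D p a b u v t : F K <= D -> arc p a b -> a <= t <= b ->
  near D u (p a) -> near D (p b) v ->
  F D < t - a \/ u = p a -> F D < b - t \/ v = p b ->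
  exists h k l, [/\ arc h k l, h k = u, h l = v &
    exists2 x, k <= x <= l & near (K + delta) (p t) (h x)].
Proof.
move=> FKD pab tab ua bv fara farb.
have d0 := delta_ge0 H; have K2 := thin_const_ge; have A1' := A1.
have K0 : 0 <= K by arith.
have KD := F_ge K0.
have [w [e [g [weg we wg]]]] := arc_ex H bv.
have eg := arc_le H weg.
have geD : g - e <= D by apply: (arc_length_le H weg); rewrite we wg.
have pat : near (t - a) (p a) (p t) by apply: (near_on_arc H pab); arith.
have ptb : near (b - t) (p t) (p b) by apply: (near_on_arc H pab); arith.
have pav := near_trans H (near_trans H pat ptb) bv.
have [q [c [d [qcd qc qd]]]] := arc_ex H pav.
have cd := arc_le H qcd.
have wvb : ends w e g v (p b) by right.
have [s sI hs] : exists2 s, c <= s <= d & near K (p t) (q s).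
  have [//|[s sI hs]] := out_thin pab qcd weg qc qd wvb tab.
  case: farb => [tb|vb].
    have hb : near D (p b) (w s) by rewrite -we; apply: (near_on_arc H weg); arith.
    have hs' : near D (p t) (w s) by apply: (near_le H) hs _; arith.
    have : b - t <= F D.
      by apply: (arc_dist_le H pab); [arith|arith|exact: (in_contract H hs' hb ptb)].
    by arith.
  exists d; first by rewrite cd lexx.
  have : g - e <= 0.
    by apply: (arc_length_le H weg); rewrite we wg vb; exact: (near_refl H).
  move=> ge; have se : s = g by arith.
  by rewrite qd -wg -se.
case: fara => [ta|ua']; last first.
  exists q, c, d; split => //; first by rewrite qc.
  by exists s => //; apply: (near_le H) hs _; arith.
have [m [k [l [mkl mk ml]]]] := arc_ex H ua.
have [h [k' [l' [hkl hk hl]]]] := arc_ex H (near_trans H ua pav).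
have e1 : ends m k l (q c) u by right; rewrite qc.
have e2 : ends h k' l' u (q d) by left; rewrite qd.
have kl := arc_le H mkl.
have lkD : l - k <= D by apply: (arc_length_le H mkl); rewrite mk ml.
have [[x xI hx]|[x xI hx]] := arc_thin H qcd mkl hkl e1 e2 sI; last first.
  exists h, k', l'; split => //; exists x => //.
  exact: (near_trans H hs hx).
have hx' : near K (m x) (q s) by apply: (near_le H) hx _; arith.
have mxa : near D (m x) (p a) by rewrite -ml; apply: (near_on_arc H mkl); arith.
have mxt : near D (m x) (p t).
  apply: (near_le H) FKD.
  exact: (in_contract H hx' hs (near_trans H mxa pat)).
have : t - a <= F D.
  by apply: (arc_dist_le H pab); [arith|arith|exact: (out_contract H mxa mxt pat)].
by arith.
Qed.

Section QuasiGeodesic.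
Variables (gamma c : R).
Hypotheses (gamma0 : 0 <= gamma) (c0 : 0 <= c).

Definition qgeod (q : R -> T) (x y : R) := x <= y /\
  forall s t, x <= s <= t -> t <= y ->
    near (gamma * (t - s) + c) (q s) (q t) /\
    forall r, near r (q s) (q t) -> t - s <= gamma * (r + c).

Lemma qgeod_log q x y : qgeod q x y -> forall n s t, x <= s <= t -> t <= y ->
  t - s <= 2 ^+ n -> forall h k l, arc h k l -> h k = q s -> h l = q t ->
  forall u, k <= u <= l ->
  exists2 s', s <= s' <= t & near (n%:R * K + gamma + c) (h u) (q s').
Proof.
move=> [_ qg]; have g0 := gamma0; have c0' := c0.
elim=> [|n IH] s t xs ty tsn h k l hkl hk hl u ukl.
  have [up _] := qg _ _ xs ty.
  exists t; first arith.
  rewrite -hl; apply: (near_on_arc H hkl); [arith|arith|].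
  have : l - k <= gamma * (t - s) + c.
    by apply: (arc_length_le H hkl); rewrite hk hl.
  have : gamma * (t - s) <= gamma * 1 by rewrite ler_wpM2l//; arith.
  by arith.
have [m [smt m1 m2]] : exists m, [/\ s <= m <= t, m - s <= 2 ^+ n & t - m <= 2 ^+ n].
  by exists ((s + t) / 2); move: tsn; rewrite exprS; split; arith.
have xsm : x <= s <= m by arith.
have my : m <= y by arith.
have xmt : x <= m <= t by arith.
have [up1 _] := qg _ _ xsm my; have [up2 _] := qg _ _ xmt ty.
have [h1 [k1 [l1 [a1 hk1 hl1]]]] := arc_ex H up1.
have [h2 [k2 [l2 [a2 hk2 hl2]]]] := arc_ex H up2.
have h1k : h1 k1 = h k by rewrite hk1 hk.
have e2 : ends h2 k2 l2 (q m) (h l) by left; rewrite hl.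
have nK : n.+1%:R * K = K + n%:R * K by rewrite -natr1; ring.
have [[v vI hv]|[v vI hv]] := out_thin hkl a1 a2 h1k hl1 e2 ukl.
- have [s' s'I hs'] := IH s m xsm my m1 h1 k1 l1 a1 hk1 hl1 v vI.
  exists s'; first arith.
  by apply: (near_le H) (near_trans H hv hs') _; arith.
- have [s' s'I hs'] := IH m t xmt ty m2 h2 k2 l2 a2 hk2 hl2 v vI.
  exists s'; first arith.
  by apply: (near_le H) (near_trans H hv hs') _; arith.
Qed.

Definition mutually_near D p (a b : R) q (x y : R) := forall t, a <= t <= b ->
  (exists2 s, x <= s <= y & near D (p t) (q s)) /\
  (exists2 s, x <= s <= y & near D (q s) (p t)).

Lemma improve_out p a b q x y D n : arc p a b -> qgeod q x y ->
  p a = q x -> p b = q y -> F (K + delta) <= D -> mutually_near D p a b q x y ->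
  gamma * (F (2 * (2 * A + 1) * D + 2 * D) + c) <= 2 ^+ n ->
  forall t, a <= t <= b -> exists2 s, x <= s <= y &
    near (K + 2 * delta + (n%:R * K + gamma + c)) (p t) (q s).
Proof.
move=> pab qxy pa pb FD sat len t tab.
have [xy qg] := qxy; have g0 := gamma0; have c0' := c0.
have d0 := delta_ge0 H; have K2 := thin_const_ge; have A1' := A1.
have Kd0 : 0 <= K + delta by arith.
have KD := F_ge Kd0.
set N := (2 * A + 1) * D.
have D1 : 1 <= D by arith.
have FDN : F D < N.
  rewrite /N; have : A * 1 <= A * D by rewrite ler_wpM2l//; arith.
  by arith.
have D0 : 0 <= D by arith.
have FD0 := F_ge D0.
have N2 : 2 * (2 * A + 1) * D = 2 * N by rewrite /N; ring.
have FKD : F K <= D by apply: le_trans FD; apply: F_mono; arith.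
have [ta [s1 [taI s1I h1 far1]]] : exists ta s1, [/\ (a <= ta <= t) && (t - ta <= N),
    x <= s1 <= y, near D (q s1) (p ta) &
    F D < t - ta \/ q s1 = p ta /\ s1 = x].
  have [lt|lt] := leP a (t - N).
    have tI : a <= t - N <= b by arith.
    have [_ [s1 s1I h1]] := sat _ tI.
    by exists (t - N), s1; split => //; [arith|left; arith].
  exists a, x; split; [arith|arith| |by right].
  by rewrite pa; exact: (near_refl H).
have [tb [s2 [tbI s2I h2 far2]]] : exists tb s2, [/\ (t <= tb <= b) && (tb - t <= N),
    x <= s2 <= y, near D (p tb) (q s2) & F D < tb - t \/ q s2 = p tb].
  have [lt|lt] := leP (t + N) b.
    have tI : a <= t + N <= b by arith.
    have [[s2 s2I h2] _] := sat _ tI.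
    by exists (t + N), s2; split => //; [arith|left; arith].
  exists b, y; split; [arith|arith| |by right].
  by rewrite pb; exact: (near_refl H).
have pab' : arc p ta tb by apply: (arc_sub H pab); arith.
have tab' : ta <= t <= tb by arith.
have far1' : F D < t - ta \/ q s1 = p ta by case: far1 => [|[]]; [left|right].
have [h [k [l [hkl hk hl [u uI hu]]]]] :=
  quadrilateral_out FKD pab' tab' h1 h2 far1' far2.
have pp : near (2 * N) (p ta) (p tb) by apply: (near_on_arc H pab'); arith.
have h12 : near (2 * N + 2 * D) (q s1) (q s2).
  by apply: (near_le H) (near_trans H (near_trans H h1 pp) h2) _; arith.
have r0 : 0 <= 2 * N + 2 * D by arith.
have rF := F_ge r0.
move: len; rewrite N2 => len.
have [s12|s21] := leP s1 s2.
  have s12x : x <= s1 <= s2 by arith.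
  have s2y : s2 <= y by arith.
  have [_ /(_ _ h12) lo] := qg _ _ s12x s2y.
  have len' : s2 - s1 <= 2 ^+ n.
    apply: le_trans lo _; apply: le_trans len.
    by rewrite ler_wpM2l//; arith.
  have [s' s'I hs'] := qgeod_log qxy s12x s2y len' hkl hk hl uI.
  exists s'; first arith.
  by apply: (near_le H) (near_trans H hu hs') _; arith.
have s21x : x <= s2 <= s1 by arith.
have s1y : s1 <= y by arith.
have [up lo] := qg _ _ s21x s1y.
have len' : s1 - s2 <= 2 ^+ n.
  apply: le_trans (lo _ (near_rev h12 up)) _; exact: len.
have [h' [k' [l' [hkl' hk' hl']]]] := arc_ex H up.
have kl := arc_le H hkl.
have hkk : arc h k k by apply: (arc_sub H hkl).
have e1 : ends h k k (h k) (h k) by left.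
have e2 : ends h' k' l' (h k) (h l) by right; rewrite hk hl.
have [[v vI hv]|[v vI hv]] := arc_thin H hkl hkk hkl' e1 e2 uI; last first.
  have [s' s'I hs'] := qgeod_log qxy s21x s1y len' hkl' hk' hl' vI.
  exists s'; first arith.
  by apply: (near_le H) (near_trans H (near_trans H hu hv) hs') _; arith.
case: far1 => [far1|[_ s1x]]; last first.
  by case/andP: s2I => xs2 _; move: s21; rewrite s1x ltNge xs2.
have vk : v = k by arith.
have hv' : near (K + delta) (q s1) (h u).
  by rewrite -hk -vk; apply: (near_le H) hv _; arith.
have pat : near (t - ta) (p ta) (p t) by apply: (near_on_arc H pab'); arith.
have q1t : near D (q s1) (p t).
  by apply: (near_le H) FD; exact: (in_contract H hv' hu (near_trans H h1 pat)).
have : t - ta <= F D.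
  by apply: (arc_dist_le H pab'); [arith|arith|exact: (out_contract H h1 q1t pat)].
by arith.
Qed.

(* Walk along the geodesic until its shadows on q jump over s: consecutive
   shadows are close to each other by contraction. *)
Lemma qgeod_near_arc D p a b q x y : 0 <= D -> arc p a b -> qgeod q x y ->
  p a = q x -> p b = q y ->
  (forall t, a <= t <= b -> exists2 s, x <= s <= y & near D (p t) (q s)) ->
  forall s, x <= s <= y -> exists2 t, a <= t <= b &
    near (D + (gamma * (gamma * (F (D + 1) + c)) + c)) (p t) (q s).
Proof.
move=> D0 pab [xy qg] pa pb sat s sI; have g0 := gamma0; have c0' := c0.
have ab := arc_le H pab.
pose S := [set t | a <= t <= b /\ exists2 s', x <= s' <= s & near D (p t) (q s')].
have Sa : S a.
  split; first by rewrite lexx.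
  by exists x; [arith|rewrite pa; exact: (near_refl H)].
have [m [mab [s1 s1I h1]] mlast] := exists_almost_last Sa (b := b)
  (fun t St => (andP (proj1 St)).2).
have [s2 s2I h2] : exists2 s2, s <= s2 <= y & near (D + 1) (p m) (q s2).
  have [mb|mb] := leP (m + 1) b.
    have mI : a <= m + 1 <= b by arith.
    have [s2 s2I h2] := sat _ mI.
    have pm : near 1 (p m) (p (m + 1)) by apply: (near_on_arc H pab); arith.
    exists s2; last by rewrite addrC; exact: (near_trans H pm h2).
    have [//|lt] := leP s s2; first arith.
    have : S (m + 1) by split => //; exists s2 => //; arith.
    by move/mlast; rewrite ltxx.
  exists y; first arith.
  by rewrite -pb; apply: (near_on_arc H pab); arith.
exists m => //; apply: (near_trans H h1).
have x12 : x <= s1 <= s2 by arith.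
have y2 : s2 <= y by arith.
have [up lo] := qg _ _ x12 y2.
have h1' : near (D + 1) (p m) (q s1) by apply: (near_le H) h1 _; arith.
have s12 := lo _ (out_contract H h1' h2 up).
have x1s : x <= s1 <= s by arith.
have ys : s <= y by arith.
have [up' _] := qg _ _ x1s ys.
apply: (near_le H) up' _; rewrite lerD2r ler_wpM2l//; arith.
Qed.

End QuasiGeodesic.
End Linear.

Lemma sqr_le_exp2 (n : nat) : (n.+1 ^ 2 <= 4 * 2 ^ n)%N.
Proof.
elim: n => // -[//|[//|n]] IH.
rewrite [(2 ^ n.+3)%N]expnS mulnCA; apply: leq_trans (leq_mul (leqnn 2) IH).
by rewrite -!mulnn; nia.
Qed.

Lemma linear_below_exp2 (R : realType) (k K C E : R) : 1 <= K -> 0 <= k ->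
  0 <= C -> 0 <= E -> exists D0, forall D, D0 <= D ->
  exists n : nat, C * D + E <= 2 ^+ n /\ k + n%:R * K <= D.
Proof.
move=> K1 k0 C0 E0; set G := C * (K + k) + E.
have G0 : 0 <= G by rewrite addr_ge0// mulr_ge0//; arith.
exists (k + 4 * G * K) => D DD.
have GK : 0 <= 4 * G * K by rewrite !mulr_ge0//; arith.
have K0 : 0 < K by arith.
have r0 : 0 <= (D - k) / K by rewrite divr_ge0//; arith.
set n := Num.truncn ((D - k) / K).
have /andP[nle nlt] := truncn_itv r0; exists n; split; last first.
  by move: nle; rewrite -/n ler_pdivlMr//; arith.
have DK : D <= k + n.+1%:R * K by move: nlt; rewrite ltr_pdivrMr//; arith.
have n4G : 4 * G <= n.+1%:R.
  by apply: le_trans (ltW nlt); rewrite ler_pdivlMr//; arith.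
have n1 : 1 <= n.+1%:R :> R by rewrite ler1n.
have n2 : n.+1%:R ^+ 2 <= 4 * 2 ^+ n :> R.
  by rewrite -!natrX -natrM ler_nat sqr_le_exp2.
have CD : C * D <= C * (k + n.+1%:R * K) by rewrite ler_wpM2l.
have kn : C * k <= C * (k * n.+1%:R) by rewrite ler_wpM2l// ler_peMr.
have En : E <= E * n.+1%:R by rewrite ler_peMr.
have : C * D + E <= G * n.+1%:R by rewrite /G; arith.
have : 4 * G * n.+1%:R <= n.+1%:R * n.+1%:R by rewrite ler_wpM2r.
by move: n2; rewrite expr2; arith.
Qed.

Section Stability.
Context (R : realType) (T : Type) (delta A gamma c : R).
Hypotheses (A1 : 1 <= A) (gamma0 : 0 <= gamma) (c0 : 0 <= c).
Local Notation F r := (A * (r + 1)).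
Local Notation K := (thin_const delta A).
Local Notation hyplin near arc :=
  (@hypspace R T near arc delta (fun r => F r)).

Lemma qgeod_opp near q x y : @qgeod R T near gamma c q x y ->
  qgeod (opp_near near) gamma c (q \o -%R) (- y) (- x).
Proof.
move=> [xy qg]; split; first by rewrite lerN2.
move=> s t ys tx.
have xt : x <= - t <= - s by arith.
have sy : - s <= y by arith.
by rewrite (_ : t - s = - s - - t); [exact: qg|ring].
Qed.

Lemma mutually_near_opp near D p a b q x y :
  @mutually_near R T near D p a b q x y ->
  mutually_near (opp_near near) D (p \o -%R) (- b) (- a) (q \o -%R) (- y) (- x).
Proof.
move=> mn t tI; have tI' : a <= - t <= b by arith.
have [[s sI hs] [s' s'I hs']] := mn _ tI'; split.
- by exists (- s'); [arith|rewrite /opp_near /= opprK].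
- by exists (- s); [arith|rewrite /opp_near /= opprK].
Qed.

Lemma arc_opp near arc p a b : hyplin near arc -> arc p a b ->
  opp_arc arc (p \o -%R) (- b) (- a).
Proof.
move=> H; rewrite /opp_arc !opprK.
by rewrite (_ : (p \o -%R) \o -%R = p)//; apply/funext => u /=; rewrite opprK.
Qed.

Lemma arc_qgeod_near : exists2 D, 0 <= D & forall near arc, hyplin near arc ->
  forall p a b q x y, arc p a b -> qgeod near gamma c q x y ->
  p a = q x -> p b = q y -> mutually_near near D p a b q x y.
Proof.
have [d0|d0] := leP 0 delta; last first.
  exists 0 => // near arc H; have := delta_ge0 H; arith.
have K2 : 2 + delta <= K.
  rewrite /thin_const; have : 0 <= F (2 * delta) by apply: mulr_ge0; have := A1; arith.
  by arith.
have A1' := A1; have g0 := gamma0; have c0' := c0.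
have FA : 0 <= A * (2 * (2 * A + 1) + 2).
  by apply: mulr_ge0; arith.
have FC : 0 <= gamma * (A * (2 * (2 * A + 1) + 2)) by exact: mulr_ge0.
have FE : 0 <= gamma * (A + c) by apply: mulr_ge0; arith.
have K1 : 1 <= K by arith.
have k0 : 0 <= K + 2 * delta + gamma + c + 1 by arith.
have [D1 D1P] := linear_below_exp2 K1 k0 FC FE.
set D0 := Num.max D1 (F (K + delta)).
have FK0 : 0 <= F (K + delta) by apply: mulr_ge0; arith.
exists D0; first by rewrite le_max FK0 orbT.
move=> near arc H p a b q x y pab qxy pa pb.
have [xy qg] := qxy.
have ab := arc_le H pab.
have [m bm] : exists m : nat, b - a <= D0 + m%:R.
  exists (Num.truncn (b - a - D0)).+1.
  by have := truncnS_gt (b - a - D0); arith.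
have : mutually_near near (D0 + m%:R) p a b q x y.
  move=> t tab; split.
  - exists y; first arith.
    by rewrite -pb; apply: (near_on_arc H pab); arith.
  - exists x; first arith.
    by rewrite -pa; apply: (near_on_arc H pab); arith.
elim: m {bm} => [|m IH]; first by rewrite addr0.
move=> mn; apply: IH; set D := D0 + m.+1%:R in mn.
have m1 : 0 <= m%:R :> R by exact: ler0n.
have DD : D = D0 + m%:R + 1 by rewrite /D -natr1 addrA.
have D0D : D0 <= D by arith.
have D1D : D1 <= D by apply: le_trans D0D; rewrite le_max lexx.
have FD : F (K + delta) <= D by apply: le_trans D0D; rewrite le_max lexx orbT.
have [n [len nD]] := D1P _ D1D.
have {}len : gamma * (F (2 * (2 * A + 1) * D + 2 * D) + c) <= 2 ^+ n.
  by apply: le_trans len; rewrite le_eqVlt; apply/orP; left; apply/eqP; ring.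
have small : K + 2 * delta + (n%:R * K + gamma + c) <= D0 + m%:R by arith.
move=> t tab; split.
- have [s sI hs] := improve_out A1 H gamma0 c0 pab qxy pa pb FD mn len tab.
  by exists s => //; exact: (near_le H hs).
- have tab' : - b <= - t <= - a by arith.
  have pa' : (p \o -%R) (- b) = (q \o -%R) (- y) by rewrite /= !opprK.
  have pb' : (p \o -%R) (- a) = (q \o -%R) (- x) by rewrite /= !opprK.
  have [s sI] := improve_out A1 (hypspace_opp H) gamma0 c0 (arc_opp H pab)
    (qgeod_opp qxy) pa' pb' FD (mutually_near_opp mn) len tab'.
  rewrite /opp_near /= opprK => hs.
  by exists (- s); [arith|exact: (near_le H hs)].
Qed.

Lemma qgeod_arc_near : exists2 D, 0 <= D & forall near arc, hyplin near arc ->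
  forall p a b q x y, arc p a b -> qgeod near gamma c q x y ->
  p a = q x -> p b = q y ->
  mutually_near near D p a b q x y /\ mutually_near near D q x y p a b.
Proof.
have [D D0 DP] := arc_qgeod_near.
set E := D + (gamma * (gamma * (F (D + 1) + c)) + c).
have DE : D <= E.
  have A1' := A1; have c0' := c0.
  rewrite lerDl addr_ge0// !mulr_ge0// addr_ge0// mulr_ge0; arith.
exists E; first arith.
move=> near arc H p a b q x y pab qxy pa pb.
have mn := DP _ _ H _ _ _ _ _ _ pab qxy pa pb.
split=> [t tab|s sI].
  have [[s sI hs] [s' s'I hs']] := mn _ tab.
  by split; [exists s|exists s'] => //; apply: (near_le H) DE.
split.
- have mno := mutually_near_opp mn.
  have sI' : - y <= - s <= - x by arith.
  have pa' : (p \o -%R) (- b) = (q \o -%R) (- y) by rewrite /= !opprK.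
  have pb' : (p \o -%R) (- a) = (q \o -%R) (- x) by rewrite /= !opprK.
  have [t tI] := qgeod_near_arc (hypspace_opp H) gamma0 c0 D0 (arc_opp H pab)
    (qgeod_opp qxy) pa' pb' (fun t tI => proj1 (mno t tI)) sI'.
  rewrite /opp_near /= opprK => ht.
  by exists (- t); [arith|].
- have [t tI ht] := qgeod_near_arc H gamma0 c0 D0 pab qxy pa pb
    (fun t tI => proj1 (mn t tI)) sI.
  by exists t.
Qed.

Lemma ends_sub (p : R -> T) a b x y s : ends p a b x y -> a <= s <= b ->
  exists a' b', [/\ a <= a', a' <= b', b' <= b & ends p a' b' x (p s)].
Proof.
move=> [] [pa pb] sI.
- by exists a, s; split; [arith|arith|arith|left].
- by exists s, b; split; [arith|arith|arith|right].
Qed.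

Lemma qgeod_thin : exists2 E, 0 <= E & forall near arc, hyplin near arc ->
  forall q1 x1 y1 q2 x2 y2 q3 x3 y3 z,
  qgeod near gamma c q1 x1 y1 -> qgeod near gamma c q2 x2 y2 ->
  qgeod near gamma c q3 x3 y3 ->
  ends q2 x2 y2 (q1 x1) z -> ends q3 x3 y3 z (q1 y1) ->
  forall s, x1 <= s <= y1 ->
  (exists2 s', x2 <= s' <= y2 & near E (q2 s') (q1 s)) \/
  (exists2 s', x3 <= s' <= y3 & near E (q1 s) (q3 s')).
Proof.
have [D D0 DP] := qgeod_arc_near.
have [d0|d0] := leP 0 delta; last first.
  exists 0 => // near arc H; have := delta_ge0 H; arith.
have A1' := A1.
have FD0 : 0 <= F (2 * D) by apply: mulr_ge0; arith.
set E := 2 * D + 3 * delta + 1 + F (2 * D).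
exists E; first by rewrite /E; arith.
move=> near arc H q1 x1 y1 q2 x2 y2 q3 x3 y3 z qg1 qg2 qg3 e2 e3 s sI.
have arcq q x y : qgeod near gamma c q x y ->
    exists p a b, [/\ arc p a b, p a = q x, p b = q y &
      mutually_near near D p a b q x y /\ mutually_near near D q x y p a b].
  move=> qxy; have [xy qg] := qxy.
  have xyI : x <= x <= y by arith.
  have [up _] := qg _ _ xyI (lexx y).
  have [p [a [b [pab pa pb]]]] := arc_ex H up.
  by exists p, a, b; split => //; exact: (DP _ _ H _ _ _ _ _ _ pab qxy pa pb).
have [p1 [a1 [b1 [pab1 pa1 pb1 [mn1 nm1]]]]] := arcq _ _ _ qg1.
have [p2 [a2 [b2 [pab2 pa2 pb2 [mn2 nm2]]]]] := arcq _ _ _ qg2.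
have [p3 [a3 [b3 [pab3 pa3 pb3 [mn3 nm3]]]]] := arcq _ _ _ qg3.
have ab1 := arc_le H pab1.
have f2 : ends p2 a2 b2 (p1 a1) z by rewrite /ends pa1 pa2 pb2.
have f3 : ends p3 a3 b3 z (p1 b1) by rewrite /ends pb1 pa3 pb3.
have from2 r u : a2 <= u <= b2 -> near r (p2 u) (q1 s) -> r + D <= E ->
    exists2 s', x2 <= s' <= y2 & near E (q2 s') (q1 s).
  move=> uI ur rE; have [_ [s' s'I hs']] := mn2 _ uI.
  by exists s' => //; apply: (near_le H) (near_trans H hs' ur) _; arith.
have to3 r u : a3 <= u <= b3 -> near r (q1 s) (p3 u) -> r + D <= E ->
    exists2 s', x3 <= s' <= y3 & near E (q1 s) (q3 s').
  move=> uI ur rE; have [[s' s'I hs'] _] := mn3 _ uI.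
  by exists s' => //; apply: (near_le H) (near_trans H ur hs') _; arith.
have [[t tI ht] [t' t'I ht']] := nm1 _ sI.
have [t'T|t'T] := leP a1 (t' - (2 * delta + 1)); last first.
  left; have h1 : near (2 * delta + 1 + D) (p1 a1) (q1 s).
    by apply: (near_trans H) ht'; apply: (near_on_arc H pab1); arith.
  have ab2 := arc_le H pab2.
  by case: f2 => -[f f']; [apply: (from2 _ a2 _ _ _)|apply: (from2 _ b2 _ _ _)];
    rewrite ?lexx ?ab2 ?f ?f' //; [exact: h1|rewrite /E; arith|exact: h1|rewrite /E; arith].
have [[y yI hy]|[y yI hy]] := arc_thin H pab1 pab2 pab3 f2 f3 tI; last first.
  right; apply: (to3 _ _ yI (near_trans H ht hy)).
  by rewrite /E; arith.
have [t't|tt'] := leP t' t.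
- have [m [k [l [mkl mk ml]]]] := arc_ex H hy.
  have kl := arc_le H mkl.
  have lk : l - k <= delta by apply: (arc_length_le H mkl); rewrite mk ml.
  have [a2' [b2' [l1 l2 l3 f4]]] := ends_sub f2 yI.
  have p2' : arc p2 a2' b2' by apply: (arc_sub H pab2).
  have p1' : arc p1 a1 t by apply: (arc_sub H pab1); arith.
  have f5 : ends m k l (p2 y) (p1 t) by left.
  set u := t' - (2 * delta + 1).
  have uI : a1 <= u <= t by rewrite /u; arith.
  have [[v vI hv]|[v vI hv]] := arc_thin H p1' p2' mkl f4 f5 uI.
  + have ut' : near (2 * delta + 1) (p1 u) (p1 t').
      by apply: (near_on_arc H pab1); rewrite /u; arith.
    left; apply: (from2 _ v _ (near_trans H hv (near_trans H ut' ht'))); first arith.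
    by rewrite /E; arith.
  + have vt : near delta (m v) (p1 t).
      by rewrite -ml; apply: (near_on_arc H mkl); arith.
    have : t - u <= delta + delta.
      by apply: (arc_dist_le H pab1) (near_trans H hv vt); arith.
    by rewrite /u; arith.
- have t't : near (D + D) (p1 t') (p1 t) by exact: (near_trans H ht' ht).
  have tt : near (t' - t) (p1 t) (p1 t') by apply: (near_on_arc H pab1); arith.
  have rev : near (F (2 * D)) (p1 t) (p1 t').
    by rewrite mulr_natl mulr2n; exact: (near_rev H t't tt).
  have [[v vI hv]|[v vI hv]] := arc_thin H pab1 pab2 pab3 f2 f3 t'I.
  + left; apply: (from2 _ _ vI (near_trans H hv ht')).
    by rewrite /E; arith.
  + right; apply: (to3 _ _ vI (near_trans H ht (near_trans H rev hv))).
    by rewrite /E; arith.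
Qed.

End Stability.

(** * Geodesics of a semimetric space *)

Section SemimetricBalls.
Context (R : realType) (X : semimetricType R).
Implicit Types x y : X.

Lemma sdistxx x : sdist x x = 0%E.
Proof. exact: (proj2 (sdist_eq0 x x)). Qed.

Lemma ball_below_finite_inter (d : X -> X -> \bar R) x (s : seq (set X)) :
  (forall y z, 0 <= d y z)%E -> (forall y z w, d y z <= d y w + d w z)%E ->
  (forall V, V \in s -> exists (z : X) (r : R), V = [set y | (d z y < r%:E)%E]) ->
  (forall V, V \in s -> V x) ->
  exists2 e : R, 0 < e &
    forall V, V \in s -> forall y, (d x y < e%:E)%E -> V y.
Proof.
move=> d0 dtri; elim: s => [_ _|V s IH sball sx]; first by exists 1.
have [V' V's|V' V's|e1 e10 h1] := IH.
- by apply: sball; rewrite inE V's orbT.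
- by apply: sx; rewrite inE V's orbT.
have [|z [r Vzr]] := sball V; first by rewrite inE eqxx.
have : V x by apply: sx; rewrite inE eqxx.
rewrite Vzr /= => zx.
have zxf : d z x \is a fin_num.
  by rewrite ge0_fin_numE// (lt_trans zx)// ltry.
have zxr : fine (d z x) < r by rewrite -lte_fin fineK.
exists (Num.min e1 (r - fine (d z x))); first by rewrite lt_min e10 subr_gt0.
move=> V'; rewrite inE => /orP[/eqP ->|V's] y xy.
  rewrite /=; apply: le_lt_trans (dtri z y x) _.
  rewrite -[d z x]fineK// -lteBrDl// -EFinB.
  by apply: lt_le_trans xy _; rewrite lee_fin ge_min lexx orbT.
by apply: h1 V's _ _; apply: lt_le_trans xy _; rewrite lee_fin ge_min lexx.
Qed.

Lemma nbhs_forward x (U : set X) : nbhs (x : forward X) U ->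
  exists2 e : R, 0 < e & forall y, (sdist x y < e%:E)%E -> U y.
Proof.
case=> _ [[C finC <-] [B CB Bx] CU].
have [F Fball defB] := finC _ CB.
pose s : seq (set X) := finmap.enum_fset F.
have sball V : V \in s -> open_out_balls V by move=> /Fball /set_mem.
have sx V : V \in s -> V x by move: Bx; rewrite -defB => /(_ V).
have [e e0 he] := ball_below_finite_inter (@sdist_ge0 R X)
  (@sdist_triangle R X) sball sx.
have ball_sub y : (sdist x y < e%:E)%E -> B y.
  by move=> xy; rewrite -defB => V VF; exact: he xy.
by exists e => // y xy; apply: CU; exists B => //; exact: ball_sub.
Qed.

Lemma forward_ball_nbhs x (e : R) : 0 < e ->
  nbhs (x : forward X) [set y | (sdist x y < e%:E)%E].
Proof.
move=> e0; exists [set y | (sdist x y < e%:E)%E]; split => //=.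
  exists [set [set y | (sdist x y < e%:E)%E]]; last by rewrite bigcup_set1.
  move=> _ ->; exists [fset [set y | (sdist x y < e%:E)%E]]%fset.
    move=> V /fset1P ->; apply: mem_set.
    suff : open_out_balls [set y | (sdist x y < e%:E)%E] by [].
    by exists x, e.
  by rewrite set_fset1 bigcap_set1.
by rewrite sdistxx lte_fin.
Qed.

Lemma nbhs_backward x (U : set X) : nbhs (x : backward X) U ->
  exists2 e : R, 0 < e & forall y, (sdist y x < e%:E)%E -> U y.
Proof.
case=> _ [[C finC <-] [B CB Bx] CU].
have [F Fball defB] := finC _ CB.
pose s : seq (set X) := finmap.enum_fset F.
have sball V : V \in s -> open_in_balls V by move=> /Fball /set_mem.
have sx V : V \in s -> V x by move: Bx; rewrite -defB => /(_ V).
have tri (y z w : X) : (sdist z y <= sdist w y + sdist z w)%E.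
  by rewrite addeC; exact: sdist_triangle.
have [e e0 he] := @ball_below_finite_inter (fun y z => sdist z y) x s
  (fun y z => sdist_ge0 z y) tri sball sx.
have ball_sub y : (sdist y x < e%:E)%E -> B y.
  by move=> xy; rewrite -defB => V VF; exact: he xy.
by exists e => // y xy; apply: CU; exists B => //; exact: ball_sub.
Qed.

Lemma backward_ball_nbhs x (e : R) : 0 < e ->
  nbhs (x : backward X) [set y | (sdist y x < e%:E)%E].
Proof.
move=> e0; exists [set y | (sdist y x < e%:E)%E]; split => //=.
  exists [set [set y | (sdist y x < e%:E)%E]]; last by rewrite bigcup_set1.
  move=> _ ->; exists [fset [set y | (sdist y x < e%:E)%E]]%fset.
    move=> V /fset1P ->; apply: mem_set.
    suff : open_in_balls [set y | (sdist y x < e%:E)%E] by [].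
    by exists x, e.
  by rewrite set_fset1 bigcap_set1.
by rewrite sdistxx lte_fin.
Qed.

End SemimetricBalls.

Section DirectedPaths.
Context (R : realType) (X : semimetricType R).

Definition path_on (P : R -> X) (a b : R) :=
  @dicontinuous R (dline R) X [set` `[a, b]] P.

Lemma dicontinuous_right (P : R -> X) a b t (e : R) : path_on P a b ->
  a <= t <= b -> 0 < e -> exists2 n : R, 0 < n &
  forall u, t <= u < t + n -> u <= b -> (sdist (P t) (P u) < e%:E)%E.
Proof.
move=> [Pf _] tab e0.
have /(subspace_continuousP _ _) := Pf.
move=> /(_ t tab) /(_ _ (forward_ball_nbhs (P t) e0)) /nbhs_forward [n n0 nP].
exists n => // u /andP[tu utn] ub; apply: nP.
  by rewrite /sdist /= /dline_dist tu lte_fin; arith.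
by rewrite /= in_itv /= ub andbT; arith.
Qed.

Lemma dicontinuous_left (P : R -> X) a b t (e : R) : path_on P a b ->
  a <= t <= b -> 0 < e -> exists2 n : R, 0 < n &
  forall u, t - n < u <= t -> a <= u -> (sdist (P u) (P t) < e%:E)%E.
Proof.
move=> [_ Pb] tab e0.
have /(subspace_continuousP _ _) := Pb.
move=> /(_ t tab) /(_ _ (backward_ball_nbhs (P t) e0)) /nbhs_backward [n n0 nP].
exists n => // u /andP[tu utn] ub; apply: nP.
  by rewrite /sdist /= /dline_dist utn lte_fin; arith.
by rewrite /= in_itv /= ub; arith.
Qed.

Lemma path_on_sub (P : R -> X) a b s t : path_on P a b -> a <= s -> t <= b ->
  path_on P s t.
Proof.
move=> [Pf Pb] as_ tb.
have sub : [set` `[s, t]] `<=` [set` `[a, b]].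
  by move=> u /=; rewrite !in_itv /=; arith.
by split; [
  exact: (@continuous_subspaceW (forward (dline R)) (forward X) _ _ P sub Pf)|
  exact: (@continuous_subspaceW (backward (dline R)) (backward X) _ _ P sub Pb)].
Qed.
End DirectedPaths.

Section UniformPartition.
Context (R : realType) (d : R -> R -> R) (s u : R).
Hypothesis su : s < u.
Hypothesis d_ge0 : forall x y, s <= x -> x <= y -> y <= u -> 0 <= d x y.
Hypothesis dxx : forall x, s <= x <= u -> d x x = 0.
Hypothesis d_tri : forall x y z, s <= x -> x <= y -> y <= z -> z <= u ->
  d x z <= d x y + d y z.
Hypothesis d_right : forall x e, s <= x <= u -> 0 < e ->
  exists2 n : R, 0 < n & forall y, x <= y < x + n -> y <= u -> d x y < e.
Hypothesis d_left : forall x e, s <= x <= u -> 0 < e ->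
  exists2 n : R, 0 < n & forall y, x - n < y <= x -> s <= y -> d y x < e.

Let node (N i : nat) : R := s + i%:R * (u - s) / N%:R.
Let cell (N : nat) (x : R) : nat := Num.truncn ((x - s) * N%:R / (u - s)).
Let chunk (N i j : nat) : R := \sum_(i <= k < j) d (node N k) (node N k.+1).

Let us0 : 0 < u - s. Proof. by rewrite subr_gt0. Qed.

Let node_le N i j : (i <= j)%N -> node N i <= node N j.
Proof.
move=> ij; rewrite /node lerD2l ler_wpM2r ?invr_ge0// ler_wpM2r ?ler_nat//.
exact: ltW.
Qed.

Let node_ge N i : s <= node N i.
Proof.
by rewrite lerDl divr_ge0// mulr_ge0// ltW.
Qed.

Let nodeN N : (0 < N)%N -> node N N = u.
Proof.
by move=> N0; rewrite /node mulrAC divff ?pnatr_eq0 -?lt0n// mul1r addrC subrK.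
Qed.

Let nodeS N i : (0 < N)%N -> node N i.+1 = node N i + (u - s) / N%:R.
Proof. by move=> N0; rewrite /node -natr1; ring. Qed.

Let cellP N x : (0 < N)%N -> s <= x <= u ->
  node N (cell N x) <= x < node N (cell N x).+1.
Proof.
move=> N0 /andP[sx xu].
have N0' : 0 < N%:R :> R by rewrite ltr0n.
have k0 : 0 <= (x - s) * N%:R / (u - s).
  by rewrite divr_ge0 ?mulr_ge0 ?subr_ge0// ltW.
have /andP[] := truncn_itv k0; rewrite -/(cell N x) => h1 h2.
rewrite /node -lerBrDl -ltrBlDl.
by rewrite ler_pdivrMr// ltr_pdivlMr// -ler_pdivlMr// -ltr_pdivrMr// h1 h2.
Qed.

Let cell_le N x y : x <= y -> (cell N x <= cell N y)%N.
Proof.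
move=> xy; apply: le_truncn; rewrite ler_wpM2r ?invr_ge0 ?(ltW us0)//.
by rewrite ler_wpM2r// lerD2r.
Qed.

Let cell_ub N x : (0 < N)%N -> s <= x <= u -> (cell N x <= N)%N.
Proof.
move=> N0 xI; have /andP[h _] := cellP N0 xI.
rewrite leqNgt; apply/negP => lt.
have : node N N.+1 <= node N (cell N x) by exact: node_le.
have /andP[_ xu] := xI.
rewrite nodeS// nodeN// => h2.
have : 0 < (u - s) / N%:R by rewrite divr_gt0// ltr0n.
by lra.
Qed.

Let d_chunk N i j : (0 < N)%N -> (i <= j <= N)%N -> d (node N i) (node N j) <= chunk N i j.
Proof.
move=> N0; elim: j => [|j IH].
  rewrite leqn0 => /andP[/eqP -> _].
  by rewrite /chunk big_geq// dxx// node_ge -(nodeN N0) node_le.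
move=> /andP[]; rewrite leq_eqVlt => /orP[/eqP <- iN|ij jN].
  by rewrite /chunk big_geq// dxx// node_ge -(nodeN N0) node_le.
rewrite /chunk big_nat_recr//= -/(chunk N i j).
apply: le_trans (lerD (IH _) (lexx _)); last by rewrite -ltnS ij ltnW.
by apply: d_tri; rewrite ?node_ge ?node_le// -(nodeN N0) node_le.
Qed.

Let chunk_ge0 N i j : (0 < N)%N -> (j <= N)%N -> 0 <= chunk N i j.
Proof.
move=> N0 jN; rewrite /chunk big_nat_cond sumr_ge0// => k /andP[/andP[_ kj] _].
apply: d_ge0; rewrite ?node_ge ?node_le// -(nodeN N0) node_le//.
exact: leq_trans jN.
Qed.

Let d_cells x y (e : R) : s <= x -> x <= y -> y <= u -> 0 < e ->
  \forall N \near \oo, d x y <= chunk N (cell N x) (cell N y) + e.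
Proof.
move=> sx xy yu e0.
have xI : s <= x <= u by lra.
have yI : s <= y <= u by lra.
move: xy; rewrite le_eqVlt => /orP[/eqP <-|xy].
  near=> N; have N0 : (0 < N)%N by near: N; exact: nbhs_infty_gt.
  by rewrite dxx// addr_ge0 ?chunk_ge0 ?cell_ub// ltW.
have e2 : 0 < e / 2 by rewrite divr_gt0.
have [n n0 nP] := d_right xI e2.
have [m m0 mP] := d_left yI e2.
set h := Num.min (y - x) (Num.min n m).
have h0 : 0 < h by rewrite !lt_min subr_gt0 xy n0 m0.
near=> N.
have N0 : (0 < N)%N by near: N; exact: nbhs_infty_gt.
have N0' : 0 < N%:R :> R by rewrite ltr0n.
have mesh : (u - s) / N%:R < h.
  rewrite ltr_pdivrMr// mulrC -ltr_pdivrMr//.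
  by near: N; exact: nbhs_infty_gtr.
have /and3P[h1 h3 h4] : [&& h <= y - x, h <= n & h <= m].
  by have := lexx h; rewrite {2}/h !le_min.
have /andP[x1 x2] := cellP N0 xI.
have /andP[y1 y2] := cellP N0 yI.
rewrite !nodeS// in x2 y2.
have xS : node N (cell N x).+1 = node N (cell N x) + (u - s) / N%:R by rewrite nodeS.
have cxy : (cell N x < cell N y)%N.
  rewrite ltnNge; apply/negP => /(node_le N); lra.
have xy1 : node N (cell N x).+1 <= node N (cell N y) by exact: node_le.
have yN := cell_ub N0 yI.
have d1 : d x (node N (cell N x).+1) < e / 2 by apply: nP; lra.
have d2 : d (node N (cell N y)) y < e / 2 by apply: mP; [lra|exact: node_ge].
have d3 : d x y <= d x (node N (cell N x).+1) + d (node N (cell N x).+1) y.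
  by apply: d_tri; lra.
have d4 : d (node N (cell N x).+1) y <=
    d (node N (cell N x).+1) (node N (cell N y)) + d (node N (cell N y)) y.
  by apply: d_tri => //; exact: node_ge.
have d5 : d (node N (cell N x).+1) (node N (cell N y)) <=
    chunk N (cell N x).+1 (cell N y) by apply: d_chunk => //; rewrite cxy.
have d6 : chunk N (cell N x).+1 (cell N y) <= chunk N (cell N x) (cell N y).
  rewrite [leRHS]/chunk big_ltn//= -/(chunk _ _ _) lerDr.
  by apply: d_ge0; rewrite ?node_ge ?node_le//; lra.
by lra.
Unshelve. all: by end_near.
Qed.

Lemma partition_sum_le (x : nat -> R) m (e : R) :
  (forall i, (i < m)%N -> x i <= x i.+1) -> x 0%N = s -> x m = u -> 0 < e ->
  \forall N \near \oo, \sum_(i < m) d (x i) (x i.+1) <=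
    \sum_(i < N) d (node N i) (node N i.+1) + e.
Proof.
move=> xle x0 xm e0.
have xmono i j : (i <= j <= m)%N -> x i <= x j.
  elim: j => [|j IH]; first by rewrite leqn0 => /andP[/eqP ->].
  move=> /andP[]; rewrite leq_eqVlt => /orP[/eqP ->//|ij jm].
  by apply: le_trans (xle _ jm); apply: IH; rewrite -ltnS ij ltnW.
have xI i : (i <= m)%N -> s <= x i <= u.
  by move=> im; rewrite -x0 -xm !xmono ?im//= leqnn.
suff : \forall N \near \oo, \sum_(i < m) d (x i) (x i.+1) <=
    chunk N (cell N (x 0%N)) (cell N (x m)) + e.
  apply: filterS2 (nbhs_infty_gt 0) => N N0 /le_trans; apply.
  rewrite lerD2r x0 xm.
  have -> : cell N s = 0%N by rewrite /cell subrr !mul0r truncn0.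
  have -> : cell N u = N by rewrite /cell mulrAC divff ?gt_eqF// mul1r natrK.
  by rewrite /chunk big_mkord.
elim: m e {xm} e0 xle xmono xI => [|m IH] e e0 xle xmono xI.
  apply: filterS (nbhs_infty_gt 0) => N N0.
  by rewrite big_ord0 addr_ge0 ?chunk_ge0 ?cell_ub ?xI// ltW.
have e2 : 0 < e / 2 by rewrite divr_gt0.
have im : (m <= m.+1)%N by [].
have /andP[sxm xmu] := xI m im; have /andP[sxm' xmu'] := xI m.+1 (leqnn _).
have IHe : \forall N \near \oo, \sum_(i < m) d (x i) (x i.+1) <=
    chunk N (cell N (x 0%N)) (cell N (x m)) + e / 2.
  apply: IH => // [i /ltnW|i j /andP[ij jm]|i /leqW]; [exact: xle| |exact: xI].
  by apply: xmono; rewrite ij leqW.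
apply: filterS2 IHe (d_cells sxm (xle m (leqnn _)) xmu' e2) => N h1 h2.
 rewrite big_ord_recr/=.
apply: le_trans (lerD h1 h2) _.
rewrite addrACA -splitr lerD2r /chunk -big_cat_nat//=; apply: cell_le.
- by apply: xmono; rewrite leq0n leqW.
- by apply: xle.
Qed.

End UniformPartition.

Lemma cvg_of_almost_sup (R : realType) (w : nat -> R) :
  (forall M (e : R), 0 < e -> \forall N \near \oo, w M <= w N + e) ->
  cvg ((fun N => (w N)%:E) @ \oo).
Proof.
move=> H; have [[B wB]|nB] := pselect (has_ubound (range w)).
  have hs : has_sup (range w) by split; [exists (w 0%N); exists 0%N|exists B].
  apply/cvg_ex; exists (sup (range w))%:E; apply: cvg_EFin.
    by near=> N.
  apply/cvgrPdist_le => e e0.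
  have e2 : 0 < e / 2 by rewrite divr_gt0.
  have [_ [M _ <-] Msup] := sup_adherent e2 hs.
  apply: filterS (H M _ e2) => N wMN /=.
  have : w N <= sup (range w) by apply: ub_le_sup; [exists B|exists N].
  by move=> h; rewrite ger0_norm; arith.
apply/cvg_ex; exists +oo%E; apply/cvgeryP/cvgryPge => B.
have [M BM] : exists M, B + 1 < w M.
  apply: contrapT => /forallNP h; apply: nB; exists (B + 1) => _ [M _ <-].
  by rewrite leNgt; apply/negP/h.
by apply: filterS (H M _ ltr01) => N; arith.
Unshelve. all: by end_near.
Qed.
Section GeodesicAdditivity.
Context (R : realType) (X : semimetricType R).

Lemma path_dist_fin (P : R -> X) a b s t : path_on P a b ->
  a <= s -> s <= t -> t <= b -> (sdist (P s) (P t) < +oo)%E.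
Proof.
move=> Pab as_ st tb.
pose S := [set u | s <= u <= t /\ (sdist (P s) (P u) < +oo)%E].
have Ss : S s by split; [rewrite lexx|rewrite sdistxx ltry].
have ubS : ubound S t by move=> u [/andP[]].
have hs : has_sup S by split; [exists s|exists t].
have sm : s <= sup S by apply: ub_le_sup => //; exists t.
have mt : sup S <= t by apply: ge_sup => //; exists s.
have mI : a <= sup S <= b by arith.
have [n n0 nP] := dicontinuous_left Pab mI ltr01.
have [u [uI fu] mu] := sup_adherent n0 hs.
have um : u <= sup S by apply: ub_le_sup => //; exists t.
have fm : (sdist (P s) (P (sup S)) < +oo)%E.
  apply: le_lt_trans (sdist_triangle _ _ (P u)) _.
  by rewrite lte_add_pinfty//; apply: lt_trans (ltry 1); apply: nP; arith.
have [n' n'0 n'P] := dicontinuous_right Pab mI ltr01.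
move: mt; rewrite le_eqVlt => /orP[/eqP <-//|mt].
have [v [mv vt vn]] : exists v, [/\ sup S < v, v <= t & v < sup S + n'].
  exists (Num.min t (sup S + n' / 2)).
  by rewrite lt_min ge_min lexx gt_min mt /=; split => //; arith.
have : S v.
  split; first arith.
  apply: le_lt_trans (sdist_triangle _ _ (P (sup S))) _.
  by rewrite lte_add_pinfty//; apply: lt_trans (ltry 1); apply: n'P; arith.
move=> Sv; have vm : v <= sup S by apply: ub_le_sup => //; exists t.
by move: mv; rewrite ltNge vm.
Qed.

Definition pdist (P : R -> X) s t : R := fine (sdist (P s) (P t)).

Lemma pdistE (P : R -> X) a b s t : path_on P a b ->
  a <= s -> s <= t -> t <= b -> sdist (P s) (P t) = (pdist P s t)%:E.
Proof.
move=> Pab as_ st tb; rewrite fineK// ge0_fin_numE ?sdist_ge0//.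
exact: (path_dist_fin Pab).
Qed.

Lemma pdist_ge0 (P : R -> X) s t : 0 <= pdist P s t.
Proof. by rewrite fine_ge0// sdist_ge0. Qed.

Lemma pdist_triangle (P : R -> X) a b s t u : path_on P a b ->
  a <= s -> s <= t -> t <= u -> u <= b ->
  pdist P s u <= pdist P s t + pdist P t u.
Proof.
move=> Pab as_ st tu ub; have := sdist_triangle (P s) (P u) (P t).
by rewrite !(pdistE Pab)//; arith.
Qed.

(* Requires the existence of the limit defining the length, since [limn] of a
   divergent sequence is the junk value 0. *)
Lemma dlength_ge (P : R -> X) a b s t u : path_on P a b ->
  a <= s -> s <= t -> t <= u -> u <= b ->
  ((pdist P s t + pdist P t u)%:E <= dlength P s u)%E.
Proof.
move=> Pab as_ st tu ub.
have := le_trans st tu; rewrite le_eqVlt => /orP[/eqP su|su].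
  have ts : t = s by arith.
  rewrite -su ts /pdist sdistxx addr0 /dlength.
  under eq_fun do under eq_bigr do rewrite subrr !mulr0 !mul0r sdistxx.
  by under eq_fun do rewrite big1_eq; rewrite lim_cst.
pose node (N i : nat) : R := s + i%:R * (u - s) / N%:R.
pose w N := \sum_(i < N) pdist P (node N i) (node N i.+1).
have d_ge0 x y : s <= x -> x <= y -> y <= u -> 0 <= pdist P x y by rewrite pdist_ge0.
have dxx x : s <= x <= u -> pdist P x x = 0 by rewrite /pdist sdistxx.
have d_tri x y z : s <= x -> x <= y -> y <= z -> z <= u ->
    pdist P x z <= pdist P x y + pdist P y z.
  by move=> *; apply: (pdist_triangle Pab); arith.
have d_right x e : s <= x <= u -> 0 < e ->
    exists2 n : R, 0 < n & forall y, x <= y < x + n -> y <= u -> pdist P x y < e.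
  move=> xI e0; have xI' : a <= x <= b by arith.
  have [n n0 nP] := dicontinuous_right Pab xI' e0; exists n => // y yI yu.
  by rewrite -lte_fin -(pdistE Pab); [apply: nP; arith|arith|arith|arith].
have d_left x e : s <= x <= u -> 0 < e ->
    exists2 n : R, 0 < n & forall y, x - n < y <= x -> s <= y -> pdist P y x < e.
  move=> xI e0; have xI' : a <= x <= b by arith.
  have [n n0 nP] := dicontinuous_left Pab xI' e0; exists n => // y yI yu.
  by rewrite -lte_fin -(pdistE Pab); [apply: nP; arith|arith|arith|arith].
have part := partition_sum_le su d_ge0 dxx d_tri d_right d_left.
have nodeI N i j : (0 < N)%N -> (i <= j <= N)%N ->
    [/\ s <= node N i, node N i <= node N j & node N j <= u].
  move=> N0 /andP[ij jN]; have N0' : 0 < N%:R :> R by rewrite ltr0n.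
  have us : 0 < u - s by arith.
  split.
  - by rewrite lerDl divr_ge0// mulr_ge0// ltW.
  - by rewrite lerD2l ler_pM2r ?invr_gt0// ler_pM2r// ler_nat.
  - rewrite -lerBrDl ler_pdivrMr// mulrC ler_pM2l// ler_nat//.
have -> : dlength P s u = limn (fun N => (w N)%:E).
  rewrite /dlength; congr (limn _); apply/funext => N.
  rewrite /w -sumEFin; apply: eq_bigr => i _.
  have N0 : (0 < N)%N by exact: (leq_ltn_trans (leq0n i) (ltn_ord i)).
  have [|h1 h2 h3] := nodeI N i i.+1 N0; first by rewrite leqnSn ltn_ord.
  by rewrite -/(node N i) -/(node N i.+1) (pdistE Pab)//; arith.
have cw : cvg ((fun N => (w N)%:E) @ \oo).
  apply: cvg_of_almost_sup => -[|M] e e0.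
    apply: nearW => N; rewrite {1}/w big_ord0; apply: addr_ge0; last exact: ltW.
    by apply: sumr_ge0 => i _; exact: pdist_ge0.
  apply: part => // [i iM||].
  - by have [|_ + _] := nodeI M.+1 i i.+1 isT; first by rewrite leqnSn.
  - by rewrite /node !mul0r addr0.
  - by rewrite /node mulrAC divff ?pnatr_eq0// mul1r addrC subrK.
apply/lee_addgt0Pr => e e0.
rewrite -leeBlDr// -EFinB; apply: lime_ge => //.
have := part (nth u [:: s; t]) 2%N e _ erefl erefl e0.
rewrite big_ord_recl big_ord1 /= => /(_ _)h.
near=> N; rewrite lee_fin lerBlDr; near: N; apply: h.
by case=> [|[|]].
Unshelve. all: by end_near.
Qed.

Lemma geodesic_add (Q : dpath X) s t u : geodesic Q ->
  dpath_lo Q <= s -> s <= t -> t <= u -> u <= dpath_hi Q ->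
  pdist Q s u = pdist Q s t + pdist Q t u.
Proof.
move=> gQ as_ st tu ub; apply/eqP; rewrite eq_le.
have pQ : path_on Q (dpath_lo Q) (dpath_hi Q) := @dpath_cont R X Q.
rewrite (pdist_triangle pQ)//=.
have := dlength_ge pQ as_ st tu ub.
by rewrite -gQ ?(pdistE pQ)// ?(le_trans st).
Qed.

End GeodesicAdditivity.

Section Segments.
Context (R : realType) (X : semimetricType R).

Definition sdist_le (r : R) (x y : X) : Prop := (sdist x y <= r%:E)%E.

Definition arclength (p : R -> X) (a b : R) (Q : dpath X) : Prop :=
  [/\ a <= b, dpath_start Q = p a, dpath_end Q = p b,
    dpath_points Q = p @` [set` `[a, b]] &
    forall s t, a <= s -> s <= t -> t <= b -> sdist (p s) (p t) = (t - s)%:E].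

Definition segment (p : R -> X) (a b : R) : Prop :=
  exists2 Q : dpath X, geodesic Q & arclength p a b Q.

Lemma path_height_surj (P : R -> X) lo hi : path_on P lo hi -> lo <= hi ->
  (forall s t, lo <= s -> s <= t -> t <= hi ->
    pdist P lo t = pdist P lo s + pdist P s t) ->
  forall r, 0 <= r <= pdist P lo hi ->
  exists2 t, lo <= t <= hi & pdist P lo t = r.
Proof.
move=> pP lohi add r rL.
have lolo : pdist P lo lo = 0 by rewrite /pdist sdistxx.
pose S := [set t | lo <= t <= hi /\ pdist P lo t <= r].
have Sl : S lo by split; [rewrite lexx|rewrite lolo; arith].
have ubS : ubound S hi by move=> u [/andP[]].
have hs : has_sup S by split; [exists lo|exists hi].
have [m em] : exists m, m = sup S by exists (sup S).
have lm : lo <= m by rewrite em; apply: ub_le_sup => //; exists hi.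
have mh : m <= hi by rewrite em; apply: ge_sup => //; exists lo.
have mI : lo <= m <= hi by rewrite lm.
exists m => //; apply/eqP; rewrite eq_le; apply/andP; split.
  apply/ler_addgt0Pr => e e0.
  have [n n0 nP] := dicontinuous_left pP mI e0.
  have [u [uI ur]] := sup_adherent n0 hs; rewrite -em => um.
  have um' : u <= m by rewrite em; apply: ub_le_sup => //; exists hi.
  have -> : pdist P lo m = pdist P lo u + pdist P u m by apply: add; arith.
  have : pdist P u m < e.
    by rewrite -lte_fin -(pdistE pP); [apply: nP|..]; arith.
  by arith.
move: mh; rewrite le_eqVlt => /orP[/eqP ->|mh]; first by arith.
apply/ler_addgt0Pr => e e0.
have [n n0 nP] := dicontinuous_right pP mI e0.
have [v [mv vt vn]] : exists v, [/\ m < v, v <= hi & v < m + n].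
  have [h|h] := leP (m + n / 2) hi; first by exists (m + n / 2); split; arith.
  by exists hi; split; arith.
have vr : r < pdist P lo v.
  rewrite ltNge; apply/negP => vr.
  have vm : v <= m.
    by rewrite em; apply: ub_le_sup; [exists hi|split => //; arith].
  by arith.
have : pdist P lo v = pdist P lo m + pdist P m v by apply: add; arith.
have : pdist P m v < e.
  by rewrite -lte_fin -(pdistE pP); [apply: nP|..]; arith.
by arith.
Qed.

Lemma geodesic_arclength (Q : dpath X) : geodesic Q ->
  exists p L, arclength p 0 L Q.
Proof.
move=> gQ; have pQ : path_on Q (dpath_lo Q) (dpath_hi Q) := @dpath_cont R X Q.
have lohi := dpath_le Q.
have add s t : dpath_lo Q <= s -> s <= t -> t <= dpath_hi Q ->
    pdist Q (dpath_lo Q) t = pdist Q (dpath_lo Q) s + pdist Q s t.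
  by move=> ls st th; apply: (geodesic_add gQ).
have ivt := path_height_surj pQ lohi add.
have [lo elo] : exists lo, lo = dpath_lo Q by exists (dpath_lo Q).
have [hi ehi] : exists hi, hi = dpath_hi Q by exists (dpath_hi Q).
rewrite -elo -ehi in pQ lohi add ivt.
pose L := pdist Q lo hi.
have L0 : 0 <= L by exact: pdist_ge0.
have mono s t : lo <= s -> s <= t -> t <= hi -> pdist Q lo s <= pdist Q lo t.
  by move=> ls st th; rewrite (add s t)// lerDl pdist_ge0.
have lolo : pdist Q lo lo = 0 by rewrite /pdist sdistxx.
have /choice[tau tauP] r : exists t, 0 <= r <= L -> lo <= t <= hi /\ pdist Q lo t = r.
  have [rL|nrL] := boolP (0 <= r <= L); last by exists 0.
  by have [t tI tr] := ivt _ rL; exists t.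
have eqQ s t : lo <= s -> s <= t -> t <= hi -> pdist Q lo s = pdist Q lo t -> Q s = Q t.
  move=> ls st th e; apply: (proj1 (sdist_eq0 _ _)).
  by rewrite (pdistE pQ)//; congr (_%:E); have := add s t ls st th; arith.
have eqQ' s t : lo <= s <= hi -> lo <= t <= hi ->
    pdist Q lo s = pdist Q lo t -> Q s = Q t.
  move=> sI tI e; have [st|st] := leP s t; first by apply: eqQ => //; arith.
  by apply/esym/eqQ => //; arith.
have LI : 0 <= L <= L by rewrite L0 lexx.
have I0 : 0 <= (0 : R) <= L by rewrite lexx L0.
have loI : lo <= lo <= hi by rewrite lexx.
have hiI : lo <= hi <= hi by rewrite lexx lohi.
exists (Q \o tau), L; split => //.
- have [tI t0] := tauP _ I0.
  by rewrite /dpath_start -elo /=; apply: eqQ' => //; rewrite t0.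
- have [tI t0] := tauP _ LI.
  by rewrite /dpath_end -ehi /=; apply: eqQ' => //; rewrite t0.
- rewrite /dpath_points -elo -ehi.
  apply/seteqP; split => [_ [t tI <-]|_ [r rI <-]].
    move: tI; rewrite /= in_itv /= => tI.
    have rI : 0 <= pdist Q lo t <= L.
      by rewrite pdist_ge0 mono//; arith.
    have [sI sr] := tauP _ rI.
    exists (pdist Q lo t); first by rewrite /= in_itv.
    by apply: eqQ'.
  move: rI; rewrite /= in_itv /= => rI.
  by have [tI _] := tauP _ rI; exists (tau r); rewrite //= in_itv.
move=> s t s0 st tL.
have sI : 0 <= s <= L by arith.
have tI : 0 <= t <= L by arith.
have [lsh es] := tauP _ sI; have [lth et] := tauP _ tI.
rewrite /=; have [ts|ts] := leP (tau s) (tau t).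
  rewrite (pdistE pQ); [|arith|arith|arith].
  have : t = s + pdist Q (tau s) (tau t).
    by rewrite -[LHS]et -[X in X + _]es; apply: add; arith.
  by move=> e; congr (_%:E); arith.
have : pdist Q lo (tau t) <= pdist Q lo (tau s) by apply: mono; arith.
rewrite es et => ts'; have st' : s = t by arith.
by rewrite st' subrr sdistxx.
Qed.

Lemma segment_sub p a b s t : segment p a b -> a <= s -> s <= t -> t <= b ->
  segment p s t.
Proof.
move=> [Q gQ [ab Qa Qb Qp iso]] as_ st tb.
have pQ : path_on Q (dpath_lo Q) (dpath_hi Q) := @dpath_cont R X Q.
have lohi := dpath_le Q.
have onQ r : a <= r <= b -> exists2 x, dpath_lo Q <= x <= dpath_hi Q &
    Q x = p r.
  move=> rI; have : dpath_points Q (p r) by rewrite Qp; exists r; rewrite //= in_itv.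
  by case=> x; rewrite /= in_itv /= => xI <-; exists x.
have height x r : dpath_lo Q <= x <= dpath_hi Q -> a <= r <= b -> Q x = p r ->
    pdist Q (dpath_lo Q) x = r - a.
  move=> xI rI e; have := Qa; rewrite /dpath_start /pdist => ->.
  by rewrite e iso ?lexx//; arith.
have mono x y : dpath_lo Q <= x -> x <= y -> y <= dpath_hi Q ->
    pdist Q (dpath_lo Q) x <= pdist Q (dpath_lo Q) y.
  by move=> lx xy yh; rewrite (geodesic_add gQ _ lx xy)// lerDl pdist_ge0.
have sI : a <= s <= b by arith.
have tI : a <= t <= b by arith.
have [x [y [lx xy yh Qx Qy]]] : exists x y, [/\ dpath_lo Q <= x, x <= y,
    y <= dpath_hi Q, Q x = p s & Q y = p t].
  have [x xI Qx] := onQ _ sI; have [y yI Qy] := onQ _ tI.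
  have [xy|yx] := leP x y; first by exists x, y; split => //; arith.
  have : pdist Q (dpath_lo Q) y <= pdist Q (dpath_lo Q) x by apply: mono; arith.
  rewrite (height _ _ xI sI Qx) (height _ _ yI tI Qy) => ts.
  have est : s = t by arith.
  by exists x, x; split => //; rewrite -?est//; arith.
exists (DPath xy (path_on_sub pQ lx yh)).
  by move=> u v /= xu uv vy; apply: gQ => //; arith.
have xI : dpath_lo Q <= x <= dpath_hi Q by arith.
have yI : dpath_lo Q <= y <= dpath_hi Q by arith.
split => //; last by move=> *; apply: iso; arith.
apply/seteqP; split => [_ [z /= zI <-]|_ [r /= rI <-]].
  move: zI; rewrite in_itv /= => zI.
  have zI' : dpath_lo Q <= z <= dpath_hi Q by arith.
  have : dpath_points Q (Q z) by exists z; rewrite //= in_itv.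
  rewrite Qp => -[r]; rewrite /= in_itv /= => rI e.
  exists r => //; rewrite in_itv /=.
  have : pdist Q (dpath_lo Q) x <= pdist Q (dpath_lo Q) z by apply: mono; arith.
  have : pdist Q (dpath_lo Q) z <= pdist Q (dpath_lo Q) y by apply: mono; arith.
  rewrite (height _ _ xI sI Qx) (height _ _ yI tI Qy) (height _ _ zI' rI (esym e)).
  by arith.
move: rI; rewrite in_itv /= => rI.
have rI' : a <= r <= b by arith.
have [z zI Qz] := onQ _ rI'.
have hz := height _ _ zI rI' Qz.
have hx := height _ _ xI sI Qx; have hy := height _ _ yI tI Qy.
have [xz|zx] := leP x z; last first.
  have : pdist Q (dpath_lo Q) z <= pdist Q (dpath_lo Q) x by apply: mono; arith.
  move=> le; have -> : r = s by arith.
  by exists x => //; rewrite /= in_itv /= lexx.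
have [zy|yz] := leP z y; first by exists z => //; rewrite /= in_itv /= xz.
have : pdist Q (dpath_lo Q) y <= pdist Q (dpath_lo Q) z by apply: mono; arith.
move=> le; have -> : r = t by arith.
by exists y => //; rewrite /= in_itv /= xy lexx.
Qed.

Lemma triangle_thin (delta : R) (P Q S : dpath X) z :
  delta_hyperbolic X delta -> geodesic P -> geodesic Q -> geodesic S ->
  joins Q (dpath_start P) z -> joins S z (dpath_end P) ->
  dpath_points P `<=`
    out_nbhd delta (dpath_points Q) `|` in_nbhd delta (dpath_points S).
Proof.
move=> hyp gP gQ gS jQ jS.
pose p (i : 'I_3) := nth z [:: z; dpath_end P; dpath_start P] i.
pose side (i : 'I_3) := nth P [:: P; Q; S] i.
have tri : geodesic_triangle p side.
  move=> [[|[|[|//]]] ?] [[|[|[|//]]] ?] [[|[|[|//]]] ?] //= _;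
    rewrite /p /side /=; split => //; move: jQ jS; rewrite /joins; tauto.
pose i0 := @Ordinal 3 0 isT; pose i1 := @Ordinal 3 1 isT; pose i2 := @Ordinal 3 2 isT.
have := hyp p side tri i0 i1 i2 isT; apply; rewrite /side /is_endpoint /=.
- by case: jQ => -[-> ->]; [left|right].
- by case: jS => -[-> ->]; [right|left].
Qed.

Lemma hypspace_segment (delta : R) (f1 f2 : R -> R) : 0 <= delta ->
  geodesic_space X -> delta_hyperbolic X delta ->
  (forall (x : X) (r : R), 0 <= r -> forall y z, out_ball r x y -> out_ball r x z ->
    sdist y z = +oo%E \/ (sdist y z <= (f1 r)%:E)%E) ->
  (forall (x : X) (r : R), 0 <= r -> forall y z, in_ball r x y -> in_ball r x z ->
    sdist y z = +oo%E \/ (sdist y z <= (f2 r)%:E)%E) ->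
  hypspace sdist_le segment delta (fun r => Num.max (f1 r) (f2 r)).
Proof.
move=> d0 geo hyp c1 c2; rewrite /sdist_le.
have ge0 r (x y : X) : (sdist x y <= r%:E)%E -> 0 <= r.
  by move=> h; rewrite -lee_fin (le_trans _ h)// sdist_ge0.
split => //.
- by move=> r x r0; rewrite sdistxx lee_fin.
- by move=> r s x y h rs; apply: le_trans h _; rewrite lee_fin.
- move=> r s x y z xy yz; apply: le_trans (sdist_triangle x z y) _.
  by rewrite EFinD leeD.
- by move=> p a b [Q _ []].
- by move=> p a b r s t [Q _ [_ _ _ _ iso]] as_ st tb; rewrite iso// lee_fin.
- by move=> p a b s t; exact: segment_sub.
- move=> r x y xy.
  have [Q [gQ <- <-]] := geo x y (le_lt_trans xy (ltry _)).
  have [p [L [L0 Qa Qb Qp iso]]] := geodesic_arclength gQ.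
  exists p, 0, L; split => //; exists Q => //.
- move=> p a b q c d r e g z t [P gP [ab Pa Pb Pp _]] [Q gQ [cd Qc Qd Qp _]]
    [S gS [eg Se Sg Sp _]] qe re tI.
  have jQ : joins Q (dpath_start P) z by rewrite /joins Qc Qd Pa.
  have jS : joins S z (dpath_end P) by rewrite /joins Se Sg Pb.
  have := triangle_thin hyp gP gQ gS jQ jS.
  move/(_ (p t)); rewrite Pp => /(_ _)[|[v]|[v]].
  + by exists t; rewrite //= in_itv.
  + by rewrite Qp => -[s]; rewrite /= in_itv /= => sI <- h; left; exists s.
  + by rewrite Sp => -[s]; rewrite /= in_itv /= => sI <- h; right; exists s.
- move=> r s x y z xy xz yz.
  have [yzoo|h] := c1 x r (ge0 _ _ _ xy) y z xy xz.
    by move: yz; rewrite yzoo leye_eq.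
  by apply: le_trans h _; rewrite lee_fin le_max lexx.
- move=> r s x y z xy xz yz.
  have [yzoo|h] := c2 x r (ge0 _ _ _ xy) y z xy xz.
    by move: yz; rewrite yzoo leye_eq.
  by apply: le_trans h _; rewrite lee_fin le_max lexx orbT.
Qed.

(* Labels of coinciding corners are interchangeable, so the sides can always be
   read as P : x -> y, Q between x and z, S between z and y. *)
Lemma thin_sides (p : 'I_3 -> X) (S : 'I_3 -> dpath X) i j k :
  geodesic_triangle p S -> uniq [:: i; j; k] ->
  is_endpoint (dpath_start (S i)) (S j) -> is_endpoint (dpath_end (S i)) (S k) ->
  [/\ geodesic (S i), geodesic (S j), geodesic (S k) &
    exists z, joins (S j) (dpath_start (S i)) z /\ joins (S k) z (dpath_end (S i))].
Proof.
move=> tri ijk sj ek.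
have [gi ji] := tri i j k ijk.
have [gj jj] : geodesic (S j) /\ joins (S j) (p i) (p k).
  by apply: tri; move: ijk; rewrite /= !inE !negb_or !andbT => /andP[/andP[]];
    rewrite eq_sym => -> -> ->.
have [gk jk] : geodesic (S k) /\ joins (S k) (p i) (p j).
  apply: tri; move: ijk; rewrite /= !inE !negb_or !andbT => /andP[/andP[ij ik] jk].
  by rewrite (eq_sym k i) ik (eq_sym k j) jk ij.
split => //; exists (p i).
suff [-> ->] : dpath_start (S i) = p k /\ dpath_end (S i) = p j.
  by split; move: jj jk; rewrite /joins; tauto.
case: ji => -[e1 e2]; last by [].
have ejk : p j = p k.
  move: sj ek; rewrite /is_endpoint e1 e2.
  by case: jj => -[-> ->]; case: jk => -[-> ->]; intuition congruence.
by rewrite e1 e2 ejk.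
Qed.

End Segments.

Lemma sdist_le_of_scaled (R : realType) (X : semimetricType R) (x y : X)
    (gamma c r : R) : 0 < gamma ->
  (gamma^-1%:E * sdist x y - c%:E <= r%:E)%E -> sdist_le (gamma * (r + c)) x y.
Proof.
move=> g0; rewrite /sdist_le; have := sdist_ge0 x y.
case: (sdist x y) => [d| |]//.
- rewrite -EFinM -EFinB !lee_fin => _; rewrite lerBlDr.
  by rewrite mulrC ler_pdivrMr// mulrC.
- by rewrite mulry gtr0_sg ?invr_gt0// mul1e.
Qed.

Theorem proposition7p2 (R : realType) (X Y : semimetricType R)
  (geoX : geodesic_space X) (geoY : geodesic_space Y)
  (hypX : hyperbolic X) (X1 : B1 X) (X2 : B2 X)
  (XY : quasi_isometric X Y) : hyperbolic Y.
Proof.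
have [delta [d0 hyp]] := hypX; have [f1 c1] := X1; have [f2 c2] := X2.
have [A A1 H] := hypspace_linear (hypspace_segment d0 geoX hyp c1 c2).
have [f [gamma [c [g1 c0 qi dense]]]] := XY.
have g0 : 0 < gamma by arith.
have gc : 0 <= gamma * c by rewrite mulr_ge0// ltW.
have gcc : c <= gamma * c by rewrite ler_peMl.
have [h hP] := choice dense.
have up r y y' : sdist_le r (h y) (h y') -> sdist_le (gamma * r + 3 * c) y y'.
  move=> hr; rewrite /sdist_le.
  apply: le_trans (sdist_triangle y y' (f (h y))) _.
  apply: le_trans (leeD (proj2 (hP y)) (sdist_triangle _ _ (f (h y')))) _.
  apply: le_trans (leeD (lexx _) (leeD (proj2 (qi _ _)) (proj1 (hP y')))) _.
  have : (gamma%:E * sdist (h y) (h y') <= (gamma * r)%:E)%E.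
    by rewrite EFinM lee_pmul2l.
  move=> {}hr; apply: le_trans (leeD (lexx _) (leeD (leeD hr (lexx _)) (lexx _))) _.
  by rewrite -!EFinD lee_fin; arith.
have down r y y' : sdist_le r y y' -> sdist_le (gamma * (r + 3 * c)) (h y) (h y').
  move=> yr; rewrite (_ : r + 3 * c = (r + 2 * c) + c); last by ring.
  apply: sdist_le_of_scaled => //; apply: le_trans (proj1 (qi _ _)) _.
  apply: le_trans (sdist_triangle _ _ y) _.
  apply: le_trans (leeD (proj1 (hP y)) (sdist_triangle _ _ y')) _.
  apply: le_trans (leeD (lexx _) (leeD yr (proj2 (hP y')))) _.
  by rewrite -!EFinD lee_fin; arith.
have gc3 : 0 <= 3 * (gamma * c) by arith.
have g0' : 0 <= gamma by exact: ltW.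
have [E E0 thinE] := qgeod_thin X delta A1 g0' gc3.
exists (gamma * E + 3 * c); split; first by rewrite addr_ge0 ?mulr_ge0.
have quasi p L Q : @arclength R Y p 0 L Q ->
    qgeod (@sdist_le R X) gamma (3 * (gamma * c)) (h \o p) 0 L.
  move=> [L0 _ _ _ iso]; split => // s t /andP[s0 st] tL; split.
    have : sdist_le (t - s) (p s) (p t) by rewrite /sdist_le iso.
    by move/down; rewrite mulrDr (_ : gamma * (3 * c) = 3 * (gamma * c)); [|ring].
  move=> r /up; rewrite /sdist_le iso// lee_fin => /le_trans; apply.
  rewrite mulrDr lerD2l mulrCA ler_wpM2l//.
  by apply: le_trans gcc _; rewrite ler_peMl.
move=> p S tri i j k ijk si ei _ [t tI <-].
have [gi gj gk [z [jj jk]]] := thin_sides tri ijk si ei.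
have [p1 [L1 a1]] := geodesic_arclength gi.
have [p2 [L2 a2]] := geodesic_arclength gj.
have [p3 [L3 a3]] := geodesic_arclength gk.
have q1 := quasi _ _ _ a1; have q2 := quasi _ _ _ a2; have q3 := quasi _ _ _ a3.
have [_ s1 e1 pt1 _] := a1; have [_ s2 e2 pt2 _] := a2; have [_ s3 e3 pt3 _] := a3.
have ends2 : ends (h \o p2) 0 L2 ((h \o p1) 0) (h z).
  by move: jj; rewrite /joins /ends /= s1 s2 e2 => -[[-> ->]|[-> ->]]; [left|right].
have ends3 : ends (h \o p3) 0 L3 (h z) ((h \o p1) L1).
  by move: jk; rewrite /joins /ends /= e1 s3 e3 => -[[-> ->]|[-> ->]]; [left|right].
have : dpath_points (S i) (S i t) by exists t.
rewrite pt1 => -[s]; rewrite /= in_itv /= => sI <-.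
have [[s' s'I near']|[s' s'I near']] :=
  thinE _ _ H _ _ _ _ _ _ _ _ _ _ q1 q2 q3 ends2 ends3 s sI.
- left; exists (p2 s'); first by rewrite pt2; exists s'; rewrite //= in_itv.
  exact: up near'.
- right; exists (p3 s'); first by rewrite pt3; exists s'; rewrite //= in_itv.
  exact: up near'.
Qed.
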